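(* Let $\Phi_1,\Phi_2,\Phi_3$ be growth functions of lower type such that $\Phi_3^{-1}\sim\Phi_1^{-1}\cdot\Phi_2^{-1}$, where $\Phi_j^{-1}$ is the inverse function of $\Phi_j$ for $j\in\{1,2,3\}$. For all $G_1\in H^{\Phi_1}(\mathbb{D})$ and $G_2\in H^{\Phi_2}(\mathbb{D})$, the product $G_1G_2$ belongs to $H^{\Phi_3}(\mathbb{D})$. Conversely, for every $G\in H^{\Phi_3}(\mathbb{D})$ there exist $G_1\in H^{\Phi_1}(\mathbb{D})$ and $G_2\in H^{\Phi_2}(\mathbb{D})$ such that $G=G_1G_2$ and, moreover, $$\|G\|_{H^{\Phi_3}}^{lux}\approx\|G_1\|_{H^{\Phi_1}}^{lux}\cdot\|G_2\|_{H^{\Phi_2}}^{lux},$$ with constants independent of $G$.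
   Context: $\mathbb{D}=\{z\in\mathbb{C}:|z|<1\}$, $\mathbb{T}=\{z\in\mathbb{C}:|z|=1\}$. A growth function is a nondecreasing function $\Phi:[0,\infty)\to[0,\infty)$ with $\lim_{t\to0}\Phi(t)=\Phi(0)=0$, $\Phi(t)>0$ for $t>0$, and $\lim_{t\to\infty}\Phi(t)=\infty$. It is of lower type $p\in(0,\infty)$ if there is a constant $C>1$ with $\Phi(st)\le Ct^{p}\Phi(s)$ for all $t\in[0,1]$, $s\in[0,\infty)$; it is of lower type if it is of lower type $p$ for some $p\in(0,\infty)$. Standing assumption: growth functions of lower type are continuous and strictly increasing, so that the inverse functions $\Phi^{-1}:[0,\infty)\to[0,\infty)$ exist. Two positive functions $\Phi,\Theta$ on $[0,\infty)$ are equivalent, written $\Phi\sim\Theta$, if there is $c>0$ with $c^{-1}\Phi(c^{-1}t)\le\Theta(t)\le c\,\Phi(ct)$ for all $t>0$. For measurable $g:\mathbb{T}\to\mathbb{C}$, $\|g\|_{L^{\Phi}}^{lux}=\inf\{\lambda>0:\int_0^{2\pi}\Phi(|g(e^{i\theta})|/\lambda)\frac{d\theta}{2\pi}\le1\}$. $H^{\Phi}(\mathbb{D})$ is the space of holomorphic functions $G$ on $\mathbb{D}$ with $\|G\|_{H^{\Phi}}^{lux}:=\sup_{0\le r<1}\|G_r\|_{L^{\Phi}}^{lux}<\infty$, where $G_r(e^{i\theta})=G(re^{i\theta})$. $A\approx A'$ means that $c^{-1}A'\le A\le cA'$ for a constant $c>0$ independent of the main parameters (here depending only on $\Phi_1,\Phi_2,\Phi_3$).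 *)

(* Defs.v *)
From HB Require Import structures.
From mathcomp Require Import all_boot all_order all_algebra.
From mathcomp Require Import complex.
From mathcomp Require Import all_classical all_reals all_analysis.

Set Implicit Arguments.
Unset Strict Implicit.
Unset Printing Implicit Defensive.

Import Order.TTheory GRing.Theory Num.Theory.
Import numFieldNormedType.Exports.
Import ComplexField.Normc.

Local Open Scope classical_set_scope.
Local Open Scope ring_scope.
Local Open Scope complex_scope.

(* Functions on [0, +oo[ are represented by total functions R -> R; only their
   values on nonnegative arguments are ever used. *)

Record growth_function (R : realType) (Phi : R -> R) : Prop := GrowthFunction {
  growth_ge0 : forall t : R, 0 <= t -> 0 <= Phi t ;
  growth_nondecreasing : forall s t : R, 0 <= s -> s <= t -> Phi s <= Phi t ;
  growth_at0 : Phi 0 = 0 ;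
  growth_cvg0 : Phi t @[t --> 0^'+] --> 0 ;
  growth_gt0 : forall t : R, 0 < t -> 0 < Phi t ;
  growth_cvgy : Phi t @[t --> +oo] --> +oo
}.

Definition of_lower_type_with (R : realType) (p : R) (Phi : R -> R) : Prop :=
  exists2 C : R, 1 < C &
    forall s t : R, 0 <= t <= 1 -> 0 <= s -> Phi (s * t) <= C * t `^ p * Phi s.

Definition of_lower_type (R : realType) (Phi : R -> R) : Prop :=
  exists2 p : R, 0 < p & of_lower_type_with p Phi.

(* Continuity and strict monotonicity do not follow from the other clauses:
   they are the standing convention on growth functions of lower type, made so
   that the inverse function exists. *)
Record lower_type_growth_function (R : realType) (Phi : R -> R) : Prop :=
  LowerTypeGrowthFunction {
  ltgf_growth : growth_function Phi ;
  ltgf_lower_type : of_lower_type Phi ;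
  ltgf_continuous : {within `[0, +oo[, continuous Phi} ;
  ltgf_increasing : forall s t : R, 0 <= s -> s < t -> Phi s < Phi t
}.

(* The default value 0 is used only off the range of Phi, which is [0, +oo[ for
   a continuous growth function. *)
Definition growth_inv (R : realType) (Phi : R -> R) : R -> R :=
  'pinv_(fun=> 0) `[0, +oo[ Phi.

Definition growth_equiv (R : realType) (Phi Theta : R -> R) : Prop :=
  exists2 c : R, 0 < c &
    forall t : R, 0 < t ->
      c^-1 * Phi (c^-1 * t) <= Theta t /\ Theta t <= c * Phi (c * t).

Definition expi (R : realType) (t : R) : R[i] := cos t +i* sin t.

Definition unit_disk (R : realType) : set R[i] := [set z | normc z < 1].
Arguments unit_disk R : clear implicits.

(* R[i]^o is R[i] as a normed space over itself, so the derivative in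
   direction 1 is the complex derivative. *)
Definition holomorphic_on (R : realType) (D : set R[i]) (G : R[i] -> R[i]) :
  Prop := forall z, D z -> derivable (G : R[i]^o -> R[i]^o) z 1.

Section HardyOrlicz.
Context {R : realType}.
Local Open Scope ereal_scope.

(* Only the values of g on the unit circle matter. The infimum is +oo when no
   lambda is admissible. *)
Definition lux_norm (Phi : R -> R) (g : R[i] -> R[i]) : \bar R :=
  ereal_inf [set l%:E | l in [set l : R | (0 < l)%R /\
    ((2 * pi)^-1)%:E *
      \int[lebesgue_measure]_(t in `[0%R, (2 * pi)%R])
        (Phi (normc (g (expi t)) / l)%R)%:E <= 1]].

Definition dilate (G : R[i] -> R[i]) (r : R) : R[i] -> R[i] :=
  fun z => G (r%:C * z)%R.

Definition hardy_norm (Phi : R -> R) (G : R[i] -> R[i]) : \bar R :=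
  ereal_sup [set lux_norm Phi (dilate G r) | r in `[0%R, 1%R[].

Definition hardy_orlicz (Phi : R -> R) : set (R[i] -> R[i]) :=
  [set G | holomorphic_on (unit_disk R) G /\ hardy_norm Phi G < +oo].

Definition approx_with (c : R) (A B : \bar R) : Prop :=
  (c^-1)%:E * B <= A /\ A <= c%:E * B.

End HardyOrlicz.

(* Main.v *)
Require Import Defs.
From HB Require Import structures.
From mathcomp Require Import all_boot all_order all_algebra.
From mathcomp Require Import complex.
From mathcomp Require Import all_classical all_reals all_analysis.
From mathcomp Require Import ring lra.

(** The product part rests on a Young inequality. Since the inverse of [Phi3] is
    comparable with the product of the other two inverses,
    [Phi3 (a * b / c) <= c * (Phi1 a + Phi2 b)] ([orlicz_young]); integrating over
    circles and using the lower type of [Phi3] to absorb the constant bounds the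
    norm of [G1 * G2] by a multiple of the product of the norms
    ([hardy_norm_product]). This is also one half of the norm equivalence.

    For the factorization let [G] be normalized so that the means of [Phi3 |G|]
    over circles are at most 1. If [G] were holomorphic on the closed disk, take on
    the unit circle [h = max |G| kappa] with a fixed [kappa > 0], and let [G1] be
    the outer function whose boundary modulus is the inverse of [Phi1] at
    [c * Phi3 h]. Then [G2 = G / G1] has boundary modulus at most [h / |G1|], which
    is at most [c] times the inverse of [Phi2] at [c * Phi3 h]. So [Phi1 |G1|] and,
    after rescaling, [Phi2 |G2|] are both dominated on the circle by [c * Phi3 h],
    whose mean is bounded by a constant. The zeros of [G] all go to [G2], so no
    Blaschke product is required.

    To carry these bounds into the disk, write [G1] as the exponential of a
    Herglotz integral, so that [log |G1|] is a Poisson integral. The function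
    [log |G2|] is below the Poisson integral of [log h - log |G1|] because
    [log |G|] is below that of [log h] ([log_poisson_majorant]): divide [G] by the
    outer function with boundary modulus [h], whose logarithmic modulus is
    continuous up to the circle, and apply the maximum principle. Lower type supplies a
    substitute for the convexity of [Phi \o expR] ([ltgf_slope]), hence a Jensen
    inequality ([ltgf_jensen]) which shows that the Poisson integral of
    [c * Phi3 h] dominates [Phi1 |G1|] and [Phi2 |G2|] up to constants. The
    circular means of that majorant are its value at the origin.

    A general [G] has no boundary values at hand. Its dilates are factored as above
    and the dilation radius is sent to 1 along an ultrafilter. The densities in the
    Herglotz integrals have bounded mass, and an exact second order identity for
    the kernel makes their pointwise limits holomorphic ([herglotz_ulim]); the
    limit of the majorants still majorizes the limit factors, and its value at the
    origin is still bounded ([outer_factorization]).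

    The complex analysis used is the mean value property and its consequence, the
    maximum principle. Holomorphy being existence of the derivative at each point,
    the mean value property is obtained from Goursat's bisection argument in the
    logarithmic coordinate. *)

Set Implicit Arguments.
Unset Strict Implicit.
Unset Printing Implicit Defensive.

Import Order.TTheory GRing.Theory Num.Theory.
Import numFieldNormedType.Exports.
Import ComplexField.Normc.

Local Open Scope classical_set_scope.
Local Open Scope ring_scope.
Local Open Scope complex_scope.

Local Notation Re := (@complex.Re _).
Local Notation Im := (@complex.Im _).

(** * Complex derivatives *)

Section ComplexDerivative.
Context {R : realType}.
Implicit Types (z w h d : R[i]) (F : R[i] -> R[i]).

Lemma normc_normr z : `|z| = (normc z)%:C.
Proof. by rewrite normc_def; case: z. Qed.

Lemma normc_ge0 z : 0 <= normc z.
Proof. by case: z => x y; rewrite /normc sqrtr_ge0. Qed.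

Lemma normcD z w : normc (z + w) <= normc z + normc w.
Proof. exact: le_normcD. Qed.

Lemma normcB z w : normc (z - w) <= normc z + normc w.
Proof. by rewrite -(normcN w); exact: normcD. Qed.

Lemma normc_sqr z : normc z ^+ 2 = Re z ^+ 2 + Im z ^+ 2.
Proof. by case: z => x y /=; rewrite sqr_sqrtr // addr_ge0 // sqr_ge0. Qed.

Lemma Re_le_normc z : `|Re z| <= normc z.
Proof.
rewrite -(@ler_pXn2r _ 2) ?nnegrE ?normc_ge0 // normc_sqr real_normK ?num_real //.
by rewrite lerDl sqr_ge0.
Qed.

Lemma Im_le_normc z : `|Im z| <= normc z.
Proof.
rewrite -(@ler_pXn2r _ 2) ?nnegrE ?normc_ge0 // normc_sqr real_normK ?num_real //.
by rewrite lerDr sqr_ge0.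
Qed.

Lemma normc_le_ReIm z : normc z <= `|Re z| + `|Im z|.
Proof.
rewrite -(@ler_pXn2r _ 2) ?nnegrE ?normc_ge0 ?addr_ge0 // normc_sqr.
rewrite sqrrD !real_normK ?num_real //.
have := mulr_ge0 (normr_ge0 (Re z)) (normr_ge0 (Im z)); lra.
Qed.

Lemma normc_real (x : R) : normc x%:C = `|x|.
Proof. by rewrite /normc /= expr0n addr0 sqrtr_sqr. Qed.

Lemma normc_gt0 z : (0 < normc z) = (z != 0).
Proof.
apply/idP/idP.
  by apply: contraTN => /eqP ->; rewrite normc0 ltxx.
move=> z0; rewrite lt_neqAle normc_ge0 andbT eq_sym.
by apply: contra z0 => /eqP/eq0_normc ->.
Qed.

(** Stated with real moduli, because the norm of [R[i]] takes its values in
    [R[i]] and cannot be compared with integrals of real functions. *)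
Definition cderiv F z d : Prop :=
  forall e : R, 0 < e -> exists2 delta : R, 0 < delta &
    forall h, normc h < delta -> normc (F (z + h) - F z - d * h) <= e * normc h.

Lemma quotient_defect (K : fieldType) (d h x : K) : h != 0 ->
  - ((d - h^-1 * x) * h) = x - d * h.
Proof. by move=> h0; field. Qed.

Lemma derivable_cderivP F z :
  derivable (F : R[i]^o -> R[i]^o) z 1 <-> exists d, cderiv F z d.
Proof.
split=> [/cvg_ex [d /= /cvgrPdist_le dF]|[d dF]].
  exists d => e e0.
  have eC : (0 : R[i]) < e%:C by rewrite ltcR.
  have := dF _ eC.
  rewrite near_withinE => /nbhs_normP [/= k k0 kP].
  have kR : k = (Re k)%:C by rewrite RRe_real // gtr0_real.
  have k0' : 0 < Re k by rewrite -ltcR -kR.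
  exists (Re k) => // h hk.
  have [->|h0] := eqVneq h 0.
    by rewrite addr0 subrr mulr0 subrr normc0 mulr0.
  have /(_ _ h0) := kP h.
  rewrite /ball_ /= sub0r normrN normc_normr kR ltcR => /(_ hk).
  rewrite normc_normr lecR.
  rewrite -(ler_pM2r (_ : 0 < normc h)) ?normc_gt0 // -normcM.
  rewrite -normcN; congr (normc _ <= _).
  rewrite [h%:A]mulr1 [_ *: _]/(h^-1 * _) (addrC h).
  exact: quotient_defect.
apply/cvg_ex; exists d; apply/cvgrPdist_le => e e0.
have eR : e = (Re e)%:C by rewrite RRe_real // gtr0_real.
have e0' : 0 < Re e by rewrite -ltcR -eR.
have [k k0 kP] := dF _ e0'.
rewrite near_withinE; apply/nbhs_normP; exists (k%:C); first by rewrite /= ltcR.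
move=> h /=; rewrite /ball_ /= sub0r normrN normc_normr ltcR => hk h0.
rewrite eR normc_normr lecR.
rewrite -(ler_pM2r (_ : 0 < normc h)) ?normc_gt0 // -normcM.
have := kP _ hk.
rewrite -normcN; congr (normc _ <= _).
rewrite [h%:A]mulr1 [_ *: _]/(h^-1 * _) (addrC h).
by apply: oppr_inj; rewrite opprK; symmetry; exact: quotient_defect.
Qed.

Definition cdiff F z : Prop := derivable (F : R[i]^o -> R[i]^o) z 1.

Lemma cdiff_cst (k : R[i]) z : cdiff (fun=> k) z.
Proof. exact: derivable_cst. Qed.

Lemma cdiff_id z : cdiff id z.
Proof. exact: derivable_id. Qed.

Lemma cdiffD F G z : cdiff F z -> cdiff G z -> cdiff (fun w => F w + G w) z.
Proof. exact: derivableD. Qed.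

Lemma cdiffB F G z : cdiff F z -> cdiff G z -> cdiff (fun w => F w - G w) z.
Proof. exact: derivableB. Qed.

Lemma cdiffM F G z : cdiff F z -> cdiff G z -> cdiff (fun w => F w * G w) z.
Proof. exact: derivableM. Qed.

Lemma cdiffV F z : F z != 0 -> cdiff F z -> cdiff (fun w => (F w)^-1) z.
Proof. by move=> F0 dF; exact: (@derivableV R[i] R[i]^o F z 1 F0 dF). Qed.

Lemma cdiff_comp F G z : cdiff G z -> cdiff F (G z) -> cdiff (fun w => F (G w)) z.
Proof.
move=> /derivable_cderivP [g dG] /derivable_cderivP [f dF].
apply/derivable_cderivP; exists (f * g) => e e0.
have g1 : 0 < normc g + 1 by have := normc_ge0 g; lra.
have f1 : 0 < normc f + 1 by have := normc_ge0 f; lra.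
have [k k0 kP] := dF (e / 2 / (normc g + 1)) ltac:(by rewrite !divr_gt0).
have [l l0 lP] := dG 1 ltr01.
have [m m0 mP] := dG (e / 2 / (normc f + 1)) ltac:(by rewrite !divr_gt0).
exists (Num.min (Num.min l m) (k / (normc g + 1))).
  by rewrite !lt_min l0 m0 divr_gt0.
move=> h; rewrite !lt_min ltr_pdivlMr // => /andP[/andP[/lP hl /mP hm] hk].
pose x := G (z + h) - G z.
have xE : G (z + h) = G z + x by rewrite [RHS]addrC subrK.
have xh : normc x <= normc h * (normc g + 1).
  have -> : x = (x - g * h) + g * h by rewrite subrK.
  by apply: le_trans (normcD _ _) _; rewrite normcM; lra.
have -> : F (G (z + h)) - F (G z) - f * g * h =
    (F (G z + x) - F (G z) - f * x) + f * (x - g * h) by rewrite xE; ring.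
apply: le_trans (normcD _ _) _; rewrite normcM.
have h1 := kP x (le_lt_trans xh hk).
have h2 : e / 2 / (normc g + 1) * normc x <= e / 2 * normc h.
  have -> : e / 2 / (normc g + 1) * normc x = e / 2 * (normc x / (normc g + 1)) by ring.
  by rewrite ler_wpM2l ?ler_pdivrMr // divr_ge0 // ltW.
have h3 : normc f * normc (x - g * h) <= e / 2 * normc h.
  apply: (@le_trans _ _ ((normc f + 1) * (e / 2 / (normc f + 1) * normc h))).
    by apply: ler_pM hm; rewrite ?normc_ge0 // lerDl.
  by rewrite mulrA (mulrC (normc f + 1)) divfK // gt_eqF.
lra.
Qed.

Lemma cdiff_continuous F z : cdiff F z -> forall e : R, 0 < e ->
  exists2 delta : R, 0 < delta &
    forall w, normc (w - z) < delta -> normc (F w - F z) < e.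
Proof.
move=> /derivable_cderivP [d dF] e e0.
have [k k0 kP] := dF 1 ltr01.
have d1 : 0 < 1 + normc d by have := normc_ge0 d; lra.
exists (Num.min k (e / (1 + normc d))).
  by rewrite lt_min k0 divr_gt0.
move=> w; rewrite lt_min => /andP[/kP wk].
rewrite ltr_pdivlMr // => we.
move: wk; rewrite [z + _]addrC subrK => wk.
have -> : F w - F z = (F w - F z - d * (w - z)) + d * (w - z) by rewrite subrK.
apply: le_lt_trans (normcD _ _) _; rewrite normcM.
by move: wk we; lra.
Qed.

Lemma eq_cdiff F G z : F =1 G -> cdiff F z -> cdiff G z.
Proof. by move=> /funext ->. Qed.

End ComplexDerivative.

(** * The complex exponential *)

Section ComplexExponential.
Context {R : realType}.
Implicit Types (z w h : R[i]).

Lemma normc_expi (t : R) : normc (expi t) = 1.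
Proof. by rewrite /normc /expi /= cos2Dsin2 sqrtr1. Qed.

Definition expC z : R[i] := (expR (Re z))%:C * expi (Im z).

Lemma expiD (s t : R) : expi (s + t) = expi s * expi t.
Proof.
by rewrite /expi cosD sinD; apply/eqP; rewrite eq_complex /= eqxx /=; apply/eqP; ring.
Qed.

Lemma expi0 : expi (0 : R) = 1.
Proof. by rewrite /expi cos0 sin0. Qed.

Lemma expCD z w : expC (z + w) = expC z * expC w.
Proof.
case: z w => [x y] [x' y'].
rewrite /expC /= expRD expiD rmorphM /=; ring.
Qed.

Lemma expC0 : expC (0 : R[i]) = 1.
Proof. by rewrite /expC /= expR0 expi0 mulr1. Qed.

Lemma normc_expC z : normc (expC z) = expR (Re z).
Proof. by rewrite normcM normc_expi mulr1 normc_real ger0_norm ?expR_ge0. Qed.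

Lemma expC_neq0 z : expC z != 0.
Proof. by rewrite -normc_gt0 normc_expC expR_gt0. Qed.

Lemma real_derive_bound (f : R -> R) (d : R) : is_derive (0 : R) 1 f d ->
  forall e : R, 0 < e -> exists2 delta : R, 0 < delta &
    forall h : R, `|h| < delta -> `|f h - f 0 - d * h| <= e * `|h|.
Proof.
move=> fd e e0.
have /derivableP : derivable f 0 1 by apply: ex_derive.
move=> -[/cvg_ex [l /= fl] _].
have ld : l = d.
  by rewrite -(@derive_val _ _ _ _ _ _ _ fd); apply/esym/cvg_lim.
move: fl; rewrite ld => /cvgrPdist_le /(_ _ e0).
rewrite near_withinE => /nbhs_normP [/= k k0 kP].
exists k => // h hk.
have [->|h0] := eqVneq h 0.
  by rewrite subrr mulr0 subrr normr0 mulr0.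
have := kP h; rewrite /ball_ /= sub0r normrN => /(_ hk h0).
rewrite addr0 [h%:A]mulr1.
rewrite -(ler_pM2r (_ : 0 < `|h|)) ?normr_gt0 // -normrM.
rewrite -normrN; congr (`|_| <= _).
rewrite [_ *: _]/(h^-1 * _); exact: quotient_defect.
Qed.

Lemma expC_cderiv0 : cderiv expC (0 : R[i]) 1.
Proof.
move=> e e0.
have [k [k0 ke k1]] : exists k : R, [/\ 0 < k, k <= e / 10 & k <= 1].
  exists (Num.min (e / 10) 1).
  by rewrite lt_min ltr01 andbT divr_gt0 // !ge_min !lexx orbT.
have [d1 d10 exp_near] := real_derive_bound (is_derive_expR 0) k0.
have [d2 d20 cos_near] := real_derive_bound (is_derive_cos 0) k0.
have [d3 d30 sin_near] := real_derive_bound (is_derive_sin 0) k0.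
exists (Num.min (Num.min d1 d2) (Num.min d3 k)).
  by rewrite !lt_min d10 d20 d30.
move=> h; rewrite !lt_min => /andP[/andP[h1 h2] /andP[h3 hk]].
have hx := Re_le_normc h; have hy := Im_le_normc h.
move: exp_near cos_near sin_near.
move=> /(_ _ (le_lt_trans hx h1)) + /(_ _ (le_lt_trans hy h2)) + /(_ _ (le_lt_trans hy h3)).
rewrite expR0 cos0 sin0 oppr0 addr0 !mul1r mul0r subr0.
rewrite add0r expC0.
have -> : expC h - 1 - h = (expR (Re h) * cos (Im h) - 1 - Re h) +i*
                           (expR (Re h) * sin (Im h) - Im h).
  case: h {h1 h2 h3 hk hx hy} => x y.
  by apply/eqP; rewrite eq_complex /=; apply/andP; split; apply/eqP; ring.
move: hx hy; move: (normc h) (Re h) (Im h) hk => n x y hk hx hy expP cosP sinP.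
apply: le_trans (normc_le_ReIm _) _ => /=.
have n0 : 0 <= n by apply: le_trans hx.
have kn : k * n <= e / 10 * n by rewrite ler_wpM2r.
have kx : k * `|x| <= k * n by rewrite ler_wpM2l // ltW.
have ky : k * `|y| <= k * n by rewrite ler_wpM2l // ltW.
have n_le1 : n <= 1 by lra.
have kn1 : k * n <= n by rewrite ler_piMl.
have ex : `|expR x - 1| <= 2 * n.
  have -> : expR x - 1 = (expR x - 1 - x) + x by ring.
  by apply: le_trans (ler_normD _ _) _; lra.
have ex3 : `|expR x| <= 3.
  have -> : expR x = (expR x - 1) + 1 by ring.
  by apply: le_trans (ler_normD _ _) _; rewrite normr1; lra.
have sy : `|sin y| <= 2 * n.
  have -> : sin y = (sin y - y) + y by ring.
  by apply: le_trans (ler_normD _ _) _; lra.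
have re_le : `|expR x * cos y - 1 - x| <= k * n + 3 * (k * n).
  have -> : expR x * cos y - 1 - x = (expR x - 1 - x) + expR x * (cos y - 1) by ring.
  apply: le_trans (ler_normD _ _) _; rewrite normrM lerD //; first lra.
  by apply: ler_pM => //; lra.
have im_le : `|expR x * sin y - y| <= k * n + 4 * (k * n).
  have -> : expR x * sin y - y = (sin y - y) + (expR x - 1) * sin y by ring.
  apply: le_trans (ler_normD _ _) _; rewrite normrM lerD //; first lra.
  apply: (@le_trans _ _ ((2 * n) * (2 * n))); first exact: ler_pM.
  have : n * n <= k * n by rewrite ler_wpM2r // ltW.
  lra.
have := mulr_ge0 (ltW e0) n0; lra.
Qed.

Lemma cdiff_expC z : cdiff expC z.
Proof.
apply/derivable_cderivP; exists (expC z) => e e0.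
have n0 : 0 < normc (expC z) by rewrite normc_gt0 expC_neq0.
have [k k0 kP] := expC_cderiv0 (divr_gt0 e0 n0).
exists k => // h /kP; rewrite add0r expC0 mul1r => hP.
have -> : expC (z + h) - expC z - expC z * h = expC z * (expC h - 1 - h).
  by rewrite expCD; ring.
rewrite normcM mulrC -ler_pdivlMr //.
by rewrite mulrAC.
Qed.

End ComplexExponential.

(** * Integrals of continuous functions on intervals *)

Section IntervalIntegral.
Context {R : realType}.
Notation mu := (@lebesgue_measure R).
Implicit Types (f g : R -> R) (a b c k : R).

(** Continuity is two-sided even at the endpoints: the integrands below are
    restrictions of functions given on both sides. *)
Definition cont_on a b f : Prop :=
  forall x, a <= x <= b -> {for x, continuous f}.

Definition Rint a b f : R := \int[mu]_(x in `[a, b]) f x.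

Lemma cont_onS a b c d f : a <= c -> d <= b -> cont_on a b f -> cont_on c d f.
Proof.
by move=> ac db fc x /andP[cx xd]; apply: fc; rewrite (le_trans ac cx) (le_trans xd db).
Qed.

Lemma cont_onT a b f : continuous f -> cont_on a b f.
Proof. by move=> fc x _; exact: fc. Qed.

Lemma cont_on_integrable a b f : cont_on a b f ->
  mu.-integrable `[a, b] (EFin \o f).
Proof.
move=> fc; apply: continuous_compact_integrable; first exact: segment_compact.
apply: continuous_in_subspaceT => x; rewrite inE /= in_itv /= => xab.
exact: fc.
Qed.

Lemma cont_onB a b f g : cont_on a b f -> cont_on a b g ->
  cont_on a b (fun x => f x - g x).
Proof. by move=> fc gc x xab; apply: cvgB; [exact: fc|exact: gc]. Qed.

Lemma cont_on_cst a b k : cont_on a b (fun=> k).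
Proof. by move=> x xab; exact: cvg_cst. Qed.

Lemma Rint_cst a b k : a <= b -> Rint a b (fun=> k) = k * (b - a).
Proof.
move=> ab; rewrite /Rint Rintegral_cst //; congr (_ * _).
have := @lebesgue_measure_itv R `[a, b]; rewrite /= => ->.
rewrite lte_fin; case: ltgtP ab => // -> _ /=.
by rewrite subrr.
Qed.

Lemma RintD a b f g : cont_on a b f -> cont_on a b g ->
  Rint a b (fun x => f x + g x) = Rint a b f + Rint a b g.
Proof. by move=> fc gc; rewrite /Rint RintegralD //; exact: cont_on_integrable. Qed.

Lemma RintB a b f g : cont_on a b f -> cont_on a b g ->
  Rint a b (fun x => f x - g x) = Rint a b f - Rint a b g.
Proof. by move=> fc gc; rewrite /Rint RintegralB //; exact: cont_on_integrable. Qed.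

Lemma RintZ a b k f : cont_on a b f ->
  Rint a b (fun x => k * f x) = k * Rint a b f.
Proof. by move=> fc; rewrite /Rint RintegralZl //; exact: cont_on_integrable. Qed.

Lemma le_Rint a b f g : cont_on a b f -> cont_on a b g ->
  (forall x, a <= x <= b -> f x <= g x) -> Rint a b f <= Rint a b g.
Proof.
move=> fc gc fg; apply: le_Rintegral => [//| | |]; 
  [exact: (cont_on_integrable fc)|exact: (cont_on_integrable gc)|].
by move=> x /=; rewrite in_itv /= => /fg.
Qed.

Lemma eq_Rint a b f g : (forall x, a <= x <= b -> f x = g x) -> Rint a b f = Rint a b g.
Proof.
move=> fg; apply: eq_Rintegral => x; rewrite inE /= in_itv /=; exact: fg.
Qed.

Lemma Rint_split a c b f : a <= c -> c <= b -> cont_on a b f ->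
  Rint a b f = Rint a c f + Rint c b f.
Proof.
move=> ac cb fc; have fi := cont_on_integrable fc.
rewrite /Rint -[RHS]addrC; apply/eqP; rewrite -subr_eq; apply/eqP.
rewrite Rintegral_itvB //.
apply: Rintegral_itv_obnd_cbnd; apply: integrableS fi => //.
apply: subset_itv; rewrite bnd_simp //; exact: ac.
Qed.

Lemma Rint_bound a b f k : a <= b -> cont_on a b f ->
  (forall x, a <= x <= b -> `|f x| <= k) -> `|Rint a b f| <= k * (b - a).
Proof.
move=> ab fc fk; rewrite -Rint_cst // ler_norml; apply/andP; split.
  rewrite Rint_cst // -mulNr -Rint_cst //.
  apply: le_Rint => // [|x /fk]; first exact: cont_on_cst.
  by rewrite ler_norml => /andP[].
apply: le_Rint => // [|x /fk]; first exact: cont_on_cst.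
by rewrite ler_norml => /andP[].
Qed.

End IntervalIntegral.

(** * Additive functions of rectangles *)

Section Goursat.
Context {R : realType}.

(** [P k x y] speaks of the rectangle with lower left corner [(x, y)] and sides
    [w / 2 ^+ k], [v / 2 ^+ k]; the booleans say which quarter is kept. *)
Lemma bisect_sequence (P : nat -> R -> R -> Prop) (w v a c : R) :
  P 0%N a c ->
  (forall k x y, P k x y -> exists i j : bool,
     P k.+1 (x + i%:R * (w / 2 ^+ k.+1)) (y + j%:R * (v / 2 ^+ k.+1))) ->
  exists s : nat -> R * R, s 0%N = (a, c) /\ forall k,
    P k (s k).1 (s k).2 /\ exists i j : bool,
     s k.+1 = ((s k).1 + i%:R * (w / 2 ^+ k.+1), (s k).2 + j%:R * (v / 2 ^+ k.+1)).
Proof.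
move=> P0 PS.
have /choice [f fP] : forall kz : nat * (R * R), exists ij : bool * bool,
    P kz.1 kz.2.1 kz.2.2 ->
    P kz.1.+1 (kz.2.1 + ij.1%:R * (w / 2 ^+ kz.1.+1))
              (kz.2.2 + ij.2%:R * (v / 2 ^+ kz.1.+1)).
  move=> [k [x y]] /=; have [/PS [i [j ijP]]|nP] := pselect (P k x y).
    by exists (i, j).
  by exists (false, false).
pose s := fix s k := if k is k'.+1 then
  ((s k').1 + (f (k', s k')).1%:R * (w / 2 ^+ k'.+1),
   (s k').2 + (f (k', s k')).2%:R * (v / 2 ^+ k'.+1)) else (a, c).
exists s; split => // k.
have sP : forall n, P n (s n).1 (s n).2.
  by elim=> [//|n IH] /=; apply: (fP (n, s n)).
by split => //; exists (f (k, s k)).1, (f (k, s k)).2.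
Qed.

(** The intervals [x k, x k + w / 2 ^+ k] are nested, so the supremum of the left
    endpoints lies in all of them. *)
Lemma bisect_limit (x : nat -> R) (w : R) : 0 <= w ->
  (forall k, exists i : bool, x k.+1 = x k + i%:R * (w / 2 ^+ k.+1)) ->
  exists l, forall k, x k <= l <= x k + w / 2 ^+ k.
Proof.
move=> w0 xS.
have wk k : w / 2 ^+ k = w / 2 ^+ k.+1 + w / 2 ^+ k.+1.
  by rewrite exprS; field; rewrite expf_neq0.
have w0k k : 0 <= w / 2 ^+ k by rewrite divr_ge0 // exprn_ge0.
have step k : x k <= x k.+1 /\ x k.+1 + w / 2 ^+ k.+1 <= x k + w / 2 ^+ k.
  have [i ->] := xS k; rewrite (wk k); have := w0k k.+1.
  by case: i; rewrite /= ?mul1r ?mul0r; lra.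
have mono k n : x k <= x (n + k)%N /\ x (n + k)%N + w / 2 ^+ (n + k) <= x k + w / 2 ^+ k.
  elim: n => [|n [IH1 IH2]]; first by rewrite add0n.
  by have [] := step (n + k)%N; rewrite addSn; lra.
have cross k n : x n <= x k + w / 2 ^+ k.
  have [kn|nk] := leqP k n.
    by have [] := mono k (n - k)%N; rewrite subnK //; have := w0k n; lra.
  by have [] := mono n (k - n)%N; rewrite subnK 1?ltnW //; have := w0k k; lra.
have hs : has_sup (range x).
  split; first by exists (x 0%N), 0%N.
  by exists (x 0%N + w / 2 ^+ 0) => _ [n _ <-].
exists (sup (range x)) => k; apply/andP; split.
  by apply: ub_le_sup; [exact: (proj2 hs)|exists k].
by apply: ge_sup => [|_ [n _ <-]]; [exact: (proj1 hs)|exact: cross].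
Qed.

(** Cousin's principle for rectangles: bisecting keeps the excess of an
    additive rectangle function over a quarter of the area, so a quantity that
    is small compared with the square of the diameter near each point has to
    vanish. *)
Lemma rectangle_additive_eq0 (E : R -> R -> R -> R -> R) (a b c d : R) :
  a <= b -> c <= d ->
  (forall x m x' y n y', a <= x -> x <= m -> m <= x' -> x' <= b ->
     c <= y -> y <= n -> n <= y' -> y' <= d ->
     E x x' y y' = E x m y n + E m x' y n + E x m n y' + E m x' n y') ->
  (forall x0 y0, a <= x0 <= b -> c <= y0 <= d -> forall e, 0 < e ->
     exists2 delta, 0 < delta & forall x x' y y',
       a <= x -> x <= x0 <= x' -> x' <= b -> c <= y -> y <= y0 <= y' -> y' <= d ->
       x' - x < delta -> y' - y < delta ->
       `|E x x' y y'| <= e * (x' - x + (y' - y)) ^+ 2) ->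
  E a b c d = 0.
Proof.
move=> ab cd Eadd Eloc; apply: contrapT => /eqP E0.
have eta0 : 0 < `|E a b c d| by rewrite normr_gt0.
set eta := `|_| in eta0.
pose w := b - a; pose v := d - c.
have w0 : 0 <= w by rewrite subr_ge0.
have v0 : 0 <= v by rewrite subr_ge0.
pose P (k : nat) x y := [/\ a <= x, x + w / 2 ^+ k <= b, c <= y, y + v / 2 ^+ k <= d &
  eta / 4 ^+ k <= `|E x (x + w / 2 ^+ k) y (y + v / 2 ^+ k)|].
have half (u : R) k : u / 2 ^+ k = u / 2 ^+ k.+1 + u / 2 ^+ k.+1.
  by rewrite exprS; field; rewrite expf_neq0.
have [|k x y [ax xb cy yd EP]|s [s0 sP]] := @bisect_sequence P w v a c.
- split; rewrite ?expr0 ?divr1 //; rewrite /w /v; try lra.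
  by rewrite (addrC a) subrK (addrC c) subrK.
- have wk := half w k; have vk := half v k.
  have w1 : 0 <= w / 2 ^+ k.+1 by rewrite divr_ge0 // exprn_ge0.
  have v1 : 0 <= v / 2 ^+ k.+1 by rewrite divr_ge0 // exprn_ge0.
  rewrite wk in xb EP; rewrite vk in yd EP.
  move: EP; rewrite (Eadd _ (x + w / 2 ^+ k.+1) _ _ (y + v / 2 ^+ k.+1)) //; try lra.
  set q1 := E _ _ _ _; set q2 := E _ _ _ _; set q3 := E _ _ _ _; set q4 := E _ _ _ _.
  move=> EP.
  have quarter : eta / 4 ^+ k = 4 * (eta / 4 ^+ k.+1).
    by rewrite exprS; field; rewrite expf_neq0.
  have := le_trans EP (ler_normD _ _).
  have := ler_normD (q1 + q2) q3; have := ler_normD q1 q2.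
  rewrite quarter => h1 h2 h3.
  have [g1|l1] := leP (eta / 4 ^+ k.+1) `|q1|.
    by exists false, false; split; rewrite /= !mul0r !addr0 //; lra.
  have [g2|l2] := leP (eta / 4 ^+ k.+1) `|q2|.
    exists true, false; split; rewrite /= ?mul0r ?mul1r ?addr0 //; try lra.
    by rewrite -[x + _ + _]addrA.
  have [g3|l3] := leP (eta / 4 ^+ k.+1) `|q3|.
    exists false, true; split; rewrite /= ?mul0r ?mul1r ?addr0 //; try lra.
    by rewrite -[y + _ + _]addrA.
  exists true, true; split; rewrite /= ?mul0r ?mul1r ?addr0 //; try lra.
  by rewrite -[x + _ + _]addrA -[y + _ + _]addrA; lra.
have [|x0 x0P] := @bisect_limit (fun k => (s k).1) w w0.
  by move=> k; have [_ [i [j ->]]] := sP k; exists i.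
have [|y0 y0P] := @bisect_limit (fun k => (s k).2) v v0.
  by move=> k; have [_ [i [j ->]]] := sP k; exists j.
have x0ab : a <= x0 <= b.
  have := x0P 0%N; rewrite s0 /= expr0 divr1 /w; lra.
have y0cd : c <= y0 <= d.
  have := y0P 0%N; rewrite s0 /= expr0 divr1 /v; lra.
have e0 : 0 < eta / (2 * (w + v + 1) ^+ 2).
  by rewrite divr_gt0 // mulr_gt0 // exprn_gt0 //; lra.
have [del del0 delP] := Eloc _ _ x0ab y0cd _ e0.
have [k kP] : exists k : nat, (w + v) / 2 ^+ k < del.
  have [n] : exists n : nat, (w + v) / del < n%:R.
    exists (Num.bound ((w + v) / del)); apply: archi_boundP.
    by apply: divr_ge0; [exact: addr_ge0|exact: ltW].
  rewrite ltr_pdivrMr // => wn; exists n.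
  rewrite ltr_pdivrMr ?exprn_gt0 //; apply: lt_le_trans wn _.
  by rewrite mulrC ler_wpM2l ?(ltW del0) // -natrX ler_nat ltnW // ltn_expl.
have [[ax xb cy yd EP] _] := sP k.
have wk0 : 0 <= w / 2 ^+ k by rewrite divr_ge0 // exprn_ge0.
have vk0 : 0 <= v / 2 ^+ k by rewrite divr_ge0 // exprn_ge0.
rewrite mulrDl in kP.
have := delP (s k).1 ((s k).1 + w / 2 ^+ k) (s k).2
  ((s k).2 + v / 2 ^+ k) ax (x0P k) xb cy (y0P k) yd.
rewrite ![_ + _ - _]addrAC !subrr !add0r => /(_ _ _) H.
have {}H := le_trans EP (H ltac:(lra) ltac:(lra)).
move: H; rewrite -mulrDl expr_div_n -exprM mulnC exprM (_ : 2 ^+ 2 = 4 :> R); last by ring.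
have p4 : 0 < (4 : R) ^+ k by rewrite exprn_gt0.
rewrite mulrA ler_pM2r ?invr_gt0 // leNgt => /negP; apply.
rewrite mulrAC ltr_pdivrMr ?mulr_gt0 ?exprn_gt0 //; try lra.
rewrite ltr_pM2l //.
apply: (@lt_le_trans _ _ ((w + v + 1) ^+ 2)).
  by rewrite ltr_pXn2r ?nnegrE //; lra.
have : 0 <= (w + v + 1) ^+ 2 by rewrite sqr_ge0.
lra.
Qed.

End Goursat.

(** * Goursat's lemma and the mean value property *)

Section MeanValue.
Context {R : realType}.
Implicit Types (p q : R -> R -> R) (F : R[i] -> R[i]).

(** Total differentiability with partial derivatives [A] and [B]. *)
Definition approx2 p (x0 y0 A B : R) : Prop := forall e, 0 < e ->
  exists2 delta, 0 < delta & forall x y, `|x - x0| < delta -> `|y - y0| < delta ->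
    `|p x y - p x0 y0 - A * (x - x0) - B * (y - y0)| <= e * (`|x - x0| + `|y - y0|).

Lemma approx2_continuousr p x0 y0 A B : approx2 p x0 y0 A B ->
  {for y0, continuous (p x0)}.
Proof.
move=> pP; apply/cvgrPdist_lt => e e0.
have [k k0 kP] := pP 1 ltr01.
have B1 : 0 < 1 + `|B| by rewrite ltr_pwDl.
apply/nbhs_normP; exists (Num.min k (e / (1 + `|B|))) => /=.
  by rewrite lt_min k0 divr_gt0.
move=> y; rewrite /ball_ /= lt_min distrC => /andP[yk].
rewrite ltr_pdivlMr // => ye.
have := kP x0 y; rewrite subrr normr0 mulr0 subr0 add0r mul1r => /(_ k0 yk) yP.
rewrite distrC; apply: le_lt_trans ye.
have -> : p x0 y - p x0 y0 = (p x0 y - p x0 y0 - B * (y - y0)) + B * (y - y0) by ring.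
by apply: le_trans (ler_normD _ _) _; rewrite normrM; lra.
Qed.

Lemma approx2_swap p x0 y0 A B : approx2 p x0 y0 A B ->
  approx2 (fun y x => p x y) y0 x0 B A.
Proof.
move=> pP e e0; have [k k0 kP] := pP e e0; exists k => // y x yk xk.
by have := kP x y xk yk; rewrite addrAC (addrC `|x - x0|).
Qed.

Lemma approx2_continuousl p x0 y0 A B : approx2 p x0 y0 A B ->
  {for x0, continuous (p ^~ y0)}.
Proof. by move=> /approx2_swap /approx2_continuousr. Qed.

(** Cauchy's theorem in divergence form, for a pair whose partials satisfy
    [dp/dx = dq/dy] at every point. On a small rectangle both differences are the
    same multiple [A] of the area up to a first order error, so the boundary
    integral is small with respect to the area. Pointwise differentiability is
    all that a function holomorphic in the sense of [holomorphic_on] provides. *)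
Lemma goursat p q (a b c d : R) : a <= b -> c <= d ->
  (forall x y, a <= x <= b -> c <= y <= d ->
     exists A B C, approx2 p x y A B /\ approx2 q x y C A) ->
  Rint c d (p b) - Rint c d (p a) = Rint a b (q ^~ d) - Rint a b (q ^~ c).
Proof.
move=> ab cd pq.
have pc x : a <= x <= b -> cont_on c d (p x).
  by move=> xab y ycd; have [A [B [C [/approx2_continuousr]]]] := pq x y xab ycd.
have qc y : c <= y <= d -> cont_on a b (q ^~ y).
  by move=> ycd x xab; have [A [B [C [_ /approx2_continuousl]]]] := pq x y xab ycd.
pose E x x' y y' := Rint y y' (fun t => p x' t - p x t) -
                    Rint x x' (fun s => q s y' - q s y).
apply/eqP; rewrite -subr_eq0; apply/eqP.
have inab x : a <= x -> x <= b -> a <= x <= b by move=> -> ->.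
have incd x : c <= x -> x <= d -> c <= x <= d by move=> -> ->.
have pcS x y y' : a <= x -> x <= b -> c <= y -> y' <= d -> cont_on y y' (p x).
  by move=> ax xb cy yd; apply: cont_onS (pc x _) => //; apply: inab.
have qcS y x x' : c <= y -> y <= d -> a <= x -> x' <= b -> cont_on x x' (q ^~ y).
  by move=> cy yd ax xb; apply: cont_onS (qc y _) => //; apply: incd.
have E0 : E a b c d = 0.
  apply: (@rectangle_additive_eq0 _ E a b c d) => //.
    move=> x m x' y n y' ax xm mx xb cy yn ny yd; rewrite /E.
    have am := le_trans ax xm; have mb := le_trans mx xb.
    have cn := le_trans cy yn; have nd := le_trans ny yd.
    have [xb' ax'] := (le_trans xm mb, le_trans am mx).
    have [yd' cy'] := (le_trans yn nd, le_trans cn ny).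
    rewrite (@Rint_split _ y n y') //; last by apply: cont_onB; apply: pcS.
    rewrite (@Rint_split _ x m x') //; last by apply: cont_onB; apply: qcS.
    rewrite !RintB; do 4?[apply: pcS => //]; do 4?[apply: qcS => //].
    ring.
  move=> x0 y0 x0ab y0cd e e0.
  have [A [B [C [pP qP]]]] := pq x0 y0 x0ab y0cd.
  have e4 : 0 < e / 4 by rewrite divr_gt0.
  have [k k0 kP] := pP _ e4; have [l l0 lP] := qP _ e4.
  exists (Num.min k l); first by rewrite lt_min k0.
  move=> x x' y y' ax /andP[xx0 x0x'] xb cy /andP[yy0 y0y'] yd.
  rewrite !lt_min => /andP[xk xl] /andP[yk yl].
  set D := x' - x + (y' - y).
  have D0 : 0 <= D by rewrite /D; lra.
  have near s t : x <= s <= x' -> y <= t <= y' ->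
      `|p s t - p x0 y0 - A * (s - x0) - B * (t - y0)| <= e / 4 * D /\
      `|q s t - q x0 y0 - C * (s - x0) - A * (t - y0)| <= e / 4 * D.
    move=> /andP[xs sx] /andP[yt ty].
    have s1 : `|s - x0| <= x' - x by rewrite ler_norml; lra.
    have t1 : `|t - y0| <= y' - y by rewrite ler_norml; lra.
    have D1 : e / 4 * (`|s - x0| + `|t - y0|) <= e / 4 * D.
      by rewrite ler_wpM2l ?(ltW e4) // lerD.
    split; (apply: le_trans D1).
      apply: kP; [exact: le_lt_trans xk|exact: le_lt_trans yk].
    apply: lP; [exact: le_lt_trans xl|exact: le_lt_trans yl].
  have xx' := le_trans xx0 x0x'; have yy' := le_trans yy0 y0y'.
  have bp t : y <= t <= y' -> `|p x' t - p x t - A * (x' - x)| <= e / 2 * D.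
    move=> yty.
    have [h1 _] := near x' t ltac:(lra) yty; have [h2 _] := near x t ltac:(lra) yty.
    set u := p x' t - _ - _ - _ in h1; set v := p x t - _ - _ - _ in h2.
    have -> : p x' t - p x t - A * (x' - x) = u - v by rewrite /u /v; ring.
    by apply: le_trans (ler_normB _ _) _; lra.
  have bq s : x <= s <= x' -> `|q s y' - q s y - A * (y' - y)| <= e / 2 * D.
    move=> xsx.
    have [_ h1] := near s y' xsx ltac:(lra); have [_ h2] := near s y xsx ltac:(lra).
    set u := q s y' - _ - _ - _ in h1; set v := q s y - _ - _ - _ in h2.
    have -> : q s y' - q s y - A * (y' - y) = u - v by rewrite /u /v; ring.
    by apply: le_trans (ler_normB _ _) _; lra.
  have ax' := le_trans ax xx'; have xb' := le_trans xx' xb.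
  have cy' := le_trans cy yy'; have yd' := le_trans yy' yd.
  have cp : cont_on y y' (fun t => p x' t - p x t) by apply: cont_onB; apply: pcS.
  have cq : cont_on x x' (fun s => q s y' - q s y) by apply: cont_onB; apply: qcS.
  have -> : E x x' y y' = Rint y y' (fun t => p x' t - p x t - A * (x' - x)) -
                          Rint x x' (fun s => q s y' - q s y - A * (y' - y)).
    rewrite /E (RintB cp) ?(RintB cq) ?Rint_cst //; try exact: cont_on_cst.
    ring.
  have h1 := Rint_bound yy' (cont_onB cp (@cont_on_cst _ _ _ _)) bp.
  have h2 := Rint_bound xx' (cont_onB cq (@cont_on_cst _ _ _ _)) bq.
  apply: le_trans (ler_normB _ _) _.
  apply: le_trans (lerD h1 h2) _.
  have : 0 <= e * D ^+ 2 by rewrite mulr_ge0 ?sqr_ge0 // ltW.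
  by rewrite -mulrDr -/D /D; nra.
move: E0; rewrite /E !RintB //.
- by apply: qc; rewrite cd lexx.
- by apply: qc; rewrite cd lexx.
- by apply: pc; rewrite ab lexx.
- by apply: pc; rewrite ab lexx.
Qed.

Definition mean (f : R -> R) : R := (2 * pi)^-1 * Rint 0 (2 * pi) f.

Lemma twopi_gt0 : 0 < 2 * pi :> R.
Proof. by rewrite mulr_gt0 // pi_gt0. Qed.

(** One of the two Cauchy-Riemann equations: the same [A] appears as the partial
    of the real part in [x] and of the imaginary part in [y]. *)
Lemma cderiv_approx2 (g : R[i] -> R[i]) (x y : R) : cdiff g (x +i* y) ->
  exists A B C, approx2 (fun s t => Re (g (s +i* t))) x y A B /\
                approx2 (fun s t => Im (g (s +i* t))) x y C A.
Proof.
move=> /derivable_cderivP [[A B] dP].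
have near e : 0 < e -> exists2 delta, 0 < delta & forall s t,
    `|s - x| < delta -> `|t - y| < delta ->
    normc (g (s +i* t) - g (x +i* y) - (A +i* B) * ((s - x) +i* (t - y)))
      <= e * (`|s - x| + `|t - y|).
  move=> e0; have [k k0 kP] := dP e e0.
  have k2 : 0 < k / 2 by rewrite divr_gt0.
  exists (k / 2) => // s t sk tk.
  have hn : normc ((s - x) +i* (t - y)) <= `|s - x| + `|t - y| by exact: normc_le_ReIm.
  have := kP ((s - x) +i* (t - y)).
  rewrite (_ : x +i* y + _ = s +i* t); last first.
    by apply/eqP; rewrite eq_complex /=; apply/andP; split; apply/eqP; ring.
  move=> /(_ ltac:(lra)) h; apply: le_trans h _.
  by rewrite ler_wpM2l // ltW.
exists A, (- B), B; split=> e e0; have [k k0 kP] := near e e0; exists k => // s t sk tk.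
  apply: le_trans (kP s t sk tk); apply: le_trans (Re_le_normc _).
  case: (g (s +i* t)) => a b; case: (g (x +i* y)) => a' b' /=.
  by rewrite le_eqVlt; apply/orP; left; apply/eqP; congr `|_|; ring.
apply: le_trans (kP s t sk tk); apply: le_trans (Im_le_normc _).
case: (g (s +i* t)) => a b; case: (g (x +i* y)) => a' b' /=.
by rewrite le_eqVlt; apply/orP; left; apply/eqP; congr `|_|; ring.
Qed.

Lemma expC_cartesian (s t : R) : expC (s +i* t) = (expR s)%:C * expi t.
Proof. by []. Qed.

Lemma expi_periodic : expi (2 * pi) = expi 0 :> R[i].
Proof. by rewrite /expi mulr_natl cos2pi sin2pi cos0 sin0. Qed.

(** The integral of [F (z0 + exp w)] around the rectangle [a <= Re w <= b],
    [0 <= Im w <= 2 pi] has no contribution from the horizontal sides, so the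
    circular means of [F] do not depend on the radius. *)
Lemma mean_value F (z0 : R[i]) (rho : R) : 0 <= rho ->
  (forall z, normc (z - z0) <= rho -> cdiff F z) ->
  mean (fun t => Re (F (z0 + rho%:C * expi t))) = Re (F z0).
Proof.
rewrite le_eqVlt => /orP[/eqP <- _|rho0 dF].
  rewrite /mean (@eq_Rint _ _ _ _ (fun=> Re (F z0))) => [|t _].
    by rewrite Rint_cst ?ltW ?twopi_gt0 // subr0 mulrCA mulVf ?mulr1 // gt_eqF // twopi_gt0.
  by rewrite mul0r addr0.
pose g w := F (z0 + expC w).
have dg s t : s <= ln rho -> cdiff g (s +i* t).
  move=> sb; apply: (@cdiff_comp _ F (fun w => z0 + expC w)).
    by apply: cdiffD; [exact: cdiff_cst|exact: cdiff_expC].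
  apply: dF; rewrite addrC addKr normc_expC /=.
  by rewrite -(lnK (rho0 : rho \is Num.pos)) ler_expR.
pose p s t := Re (g (s +i* t)).
pose q s t := Im (g (s +i* t)).
have tp := twopi_gt0.
have same s : s <= ln rho -> Rint 0 (2 * pi) (p (ln rho)) = Rint 0 (2 * pi) (p s).
  move=> sb; apply/eqP; rewrite -subr_eq0.
  rewrite (@goursat p q s (ln rho) 0 (2 * pi)) //; last 2 first.
  - exact: ltW.
  - by move=> x y /andP[_ xb] _; apply: cderiv_approx2; exact: dg.
  rewrite subr_eq0; apply/eqP; apply: eq_Rint => x _.
  by rewrite /q /g !expC_cartesian expi_periodic.
have pE s t : p s t = Re (F (z0 + (expR s)%:C * expi t)) by [].
have -> : mean (fun t => Re (F (z0 + rho%:C * expi t))) =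
          (2 * pi)^-1 * Rint 0 (2 * pi) (p (ln rho)).
  rewrite /mean; congr (_ * _); apply: eq_Rint => t _.
  by rewrite pE lnK.
apply/eqP; rewrite -subr_eq0 -normr_le0; apply/ler_addgt0Pl => e e0; rewrite addr0.
have dF0 : cdiff F z0 by apply: dF; rewrite subrr normc0 ltW.
have [k k0 kP] := cdiff_continuous dF0 e0.
pose s := Num.min (ln rho) (ln (k / 2)).
have k2 : 0 < k / 2 by rewrite divr_gt0.
have es : expR s < k.
  apply: (@le_lt_trans _ _ (k / 2)); last lra.
  by rewrite -[leRHS](lnK (k2 : _ \is Num.pos)) ler_expR ge_min lexx orbT.
have sb : s <= ln rho by rewrite ge_min lexx.
rewrite (same s) //.
have pc : cont_on 0 (2 * pi) (p s).
  by move=> t _; have [A [B [C [/approx2_continuousr]]]] := cderiv_approx2 (dg s t sb).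
have bound : `|Rint 0 (2 * pi) (fun t => p s t - Re (F z0))| <= e * (2 * pi - 0).
  apply: Rint_bound; first exact: ltW.
    by apply: cont_onB pc _; exact: cont_on_cst.
  move=> t _; rewrite pE -raddfB; apply: le_trans (Re_le_normc _) _.
  apply/ltW/kP; rewrite addrC addKr normcM normc_expi mulr1 normc_real.
  by rewrite ger0_norm // expR_ge0.
rewrite RintB // in bound; last exact: cont_on_cst.
rewrite (Rint_cst _ (ltW tp)) !subr0 in bound.
have -> : (2 * pi)^-1 * Rint 0 (2 * pi) (p s) - Re (F z0) =
          (2 * pi)^-1 * (Rint 0 (2 * pi) (p s) - Re (F z0) * (2 * pi)).
  by rewrite mulrBr mulrCA mulVf ?mulr1 // gt_eqF.
by rewrite normrM gtr0_norm ?invr_gt0 // mulrC ler_pdivrMr.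
Qed.

End MeanValue.

(** * Means over the circle *)

Section CircularMean.
Context {R : realType}.
Implicit Types (f g : R -> R) (u v : R -> R[i]) (k : R).

Lemma mean_cst k : mean (fun=> k) = k.
Proof.
rewrite /mean (Rint_cst _ (ltW twopi_gt0)) subr0 mulrCA mulVf ?mulr1 //.
by rewrite gt_eqF // twopi_gt0.
Qed.

Lemma meanD f g : continuous f -> continuous g ->
  mean (fun t => f t + g t) = mean f + mean g.
Proof. by move=> fc gc; rewrite /mean RintD ?mulrDr //; exact: cont_onT. Qed.

Lemma meanB f g : continuous f -> continuous g ->
  mean (fun t => f t - g t) = mean f - mean g.
Proof. by move=> fc gc; rewrite /mean RintB ?mulrBr //; exact: cont_onT. Qed.

Lemma meanZ k f : continuous f -> mean (fun t => k * f t) = k * mean f.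
Proof. by move=> fc; rewrite /mean RintZ; [exact: mulrCA|exact: cont_onT]. Qed.

Lemma le_mean f g : continuous f -> continuous g -> (forall t, f t <= g t) ->
  mean f <= mean g.
Proof.
move=> fc gc fg; apply: ler_wpM2l; first by rewrite invr_ge0 ltW // twopi_gt0.
by apply: le_Rint => [| |x _]; [exact: cont_onT..|exact: fg].
Qed.

Lemma eq_mean f g : f =1 g -> mean f = mean g.
Proof. by move=> /funext ->. Qed.

Lemma continuous_cstR k : continuous (fun _ : R => k).
Proof. by move=> t; exact: cvg_cst. Qed.

Lemma continuousDR f g : continuous f -> continuous g -> continuous (fun t => f t + g t).
Proof. by move=> fc gc t; apply: cvgD; [exact: fc|exact: gc]. Qed.

Lemma continuousBR f g : continuous f -> continuous g -> continuous (fun t => f t - g t).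
Proof. by move=> fc gc t; apply: cvgB; [exact: fc|exact: gc]. Qed.

Lemma continuousMR f g : continuous f -> continuous g -> continuous (fun t => f t * g t).
Proof. by move=> fc gc t; apply: cvgM; [exact: fc|exact: gc]. Qed.

Lemma continuousZR k f : continuous f -> continuous (fun t => k * f t).
Proof. by move=> fc; apply: continuousMR fc; exact: continuous_cstR. Qed.

Lemma continuous_normR f : continuous f -> continuous (fun t => `|f t|).
Proof. by move=> fc t; apply: cvg_norm; exact: fc. Qed.

(** Continuity by coordinates is the form which integrals of real and imaginary
    parts consume. *)
Definition ccont u : Prop :=
  continuous (fun t => Re (u t)) /\ continuous (fun t => Im (u t)).

Lemma ccontP u : ccont u <-> forall t e, 0 < e -> exists2 delta, 0 < delta &
  forall s, `|s - t| < delta -> normc (u s - u t) < e.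
Proof.
split=> [[uR uI] t e e0|uP].
  have e2 : 0 < e / 2 by rewrite divr_gt0.
  move/cvgrPdist_lt : (uR t) => /(_ _ e2) /nbhs_normP [k /= k0 kP].
  move/cvgrPdist_lt : (uI t) => /(_ _ e2) /nbhs_normP [l /= l0 lP].
  exists (Num.min k l); first by rewrite lt_min k0.
  move=> s; rewrite distrC lt_min => /andP[/kP sk /lP sl].
  rewrite /= in sk sl.
  apply: le_lt_trans (normc_le_ReIm _) _.
  by rewrite !raddfB /= distrC (distrC (Im _)); lra.
split=> t; apply/cvgrPdist_lt => e /(uP t) [k k0 kP];
  apply/nbhs_normP; exists k => //= s; rewrite /ball_ /= distrC => /kP h;
  rewrite distrC -raddfB; apply: le_lt_trans h; [exact: Re_le_normc|exact: Im_le_normc].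
Qed.

Lemma ccont_cst (k : R[i]) : ccont (fun=> k).
Proof. by split; exact: continuous_cstR. Qed.

Lemma ccontD u v : ccont u -> ccont v -> ccont (fun t => u t + v t).
Proof.
move=> [uR uI] [vR vI]; split.
  by under [X in continuous X]eq_fun do rewrite raddfD; exact: continuousDR.
by under [X in continuous X]eq_fun do rewrite raddfD; exact: continuousDR.
Qed.

Lemma ccontB u v : ccont u -> ccont v -> ccont (fun t => u t - v t).
Proof.
move=> [uR uI] [vR vI]; split.
  by under [X in continuous X]eq_fun do rewrite raddfB; exact: continuousBR.
by under [X in continuous X]eq_fun do rewrite raddfB; exact: continuousBR.
Qed.

Lemma Re_mul (z w : R[i]) : Re (z * w) = Re z * Re w - Im z * Im w.
Proof. by case: z w => [a b] [c d]. Qed.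

Lemma Im_mul (z w : R[i]) : Im (z * w) = Re z * Im w + Im z * Re w.
Proof. by case: z w => [a b] [c d]. Qed.

Lemma Re_opp (z : R[i]) : Re (- z) = - Re z.
Proof. by case: z. Qed.

Lemma ccontM u v : ccont u -> ccont v -> ccont (fun t => u t * v t).
Proof.
move=> [uR uI] [vR vI]; split.
  under [X in continuous X]eq_fun do rewrite Re_mul.
  by apply: continuousBR; exact: continuousMR.
under [X in continuous X]eq_fun do rewrite Im_mul.
by apply: continuousDR; exact: continuousMR.
Qed.

Lemma ccont_real f : continuous f -> ccont (fun t => (f t)%:C).
Proof. by move=> fc; split => //; exact: continuous_cstR. Qed.

Lemma ccont_expi : ccont (@expi R).
Proof. by split; [exact: continuous_cos|exact: continuous_sin]. Qed.

Lemma ccont_cdiff F u : (forall t, cdiff F (u t)) -> ccont u ->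
  ccont (fun t => F (u t)).
Proof.
move=> dF /ccontP uc; apply/ccontP => t e e0.
have [k k0 kP] := cdiff_continuous (dF t) e0.
by have [l l0 lP] := uc t k k0; exists l => // s /lP /kP.
Qed.

Lemma normc_dist (z w : R[i]) : `|normc z - normc w| <= normc (z - w).
Proof.
rewrite ler_norml; apply/andP; split.
  rewrite lerNl opprB lerBlDr -(normcN (_ - _)) opprB.
  by apply: le_trans (normcD _ _); rewrite subrK.
by rewrite lerBlDr; apply: le_trans (normcD _ _); rewrite subrK.
Qed.

Lemma continuous_normc u : ccont u -> continuous (fun t => normc (u t)).
Proof.
move=> /ccontP uP t; apply/cvgrPdist_lt => e /(uP t) [k k0 kP].
apply/nbhs_normP; exists k => //= s; rewrite /ball_ /= distrC => /kP h.
by apply: le_lt_trans h; rewrite distrC; exact: normc_dist.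
Qed.

Definition cmean u : R[i] := mean (fun t => Re (u t)) +i* mean (fun t => Im (u t)).

Lemma cmeanB u v : ccont u -> ccont v ->
  cmean (fun t => u t - v t) = cmean u - cmean v.
Proof.
move=> [uR uI] [vR vI]; apply/eqP; rewrite eq_complex /= -!meanB //.
by apply/andP; split; apply/eqP; apply: eq_mean => t; rewrite raddfB.
Qed.

Lemma cmeanZ (k : R[i]) u : ccont u -> cmean (fun t => k * u t) = k * cmean u.
Proof.
move=> [uR uI]; apply/eqP; rewrite eq_complex Re_mul Im_mul /= -!meanZ //.
rewrite -meanB; [|exact: continuousZR..].
rewrite -meanD; [|exact: continuousZR..].
by apply/andP; split; apply/eqP; apply: eq_mean => t; rewrite ?Re_mul ?Im_mul.
Qed.

(** The factor 2 comes from bounding the real and imaginary parts separately;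
    only the order of magnitude matters below. *)
Lemma normc_cmean u f (B : R) : ccont u -> continuous f ->
  (forall t, normc (u t) <= B * f t) -> normc (cmean u) <= 2 * (B * mean f).
Proof.
move=> [uR uI] fc uB; apply: le_trans (normc_le_ReIm _) _.
have bound (g : R -> R) : continuous g -> (forall t, `|g t| <= normc (u t)) ->
    `|mean g| <= B * mean f.
  move=> gc gu; rewrite ler_norml; apply/andP; split.
    rewrite -mulNr -meanZ //; apply: le_mean => // [|t].
      exact: continuousZR.
    rewrite mulNr lerNl; apply: le_trans (uB t); apply: le_trans (gu t).
    by rewrite -normrN ler_norm.
  rewrite -meanZ //; apply: le_mean => // [|t].
    exact: continuousZR.
  by apply: le_trans (uB t); apply: le_trans (gu t); rewrite ler_norm.
have := bound _ uR (fun t => Re_le_normc _); have := bound _ uI (fun t => Im_le_normc _).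
rewrite /=; lra.
Qed.

End CircularMean.

(** * The maximum principle *)

Section MaximumPrinciple.
Context {R : realType}.
Implicit Types (z w : R[i]) (F : R[i] -> R[i]).

Lemma normc_conj z : normc z^* = normc z.
Proof. by case: z => a b /=; rewrite sqrrN. Qed.

Lemma mulcJ_normc z : z * z^* = (normc z ^+ 2)%:C.
Proof.
rewrite normc_sqr; case: z => a b; apply/eqP; rewrite eq_complex /=.
by apply/andP; split; apply/eqP; ring.
Qed.

Lemma subc_neq0 (k : R) z w : normc z <= k -> k < normc w -> w - z != 0.
Proof. by move=> zk kw; rewrite subr_eq0; apply: contraTneq kw => ->; rewrite -leNgt. Qed.

Definition mobius z w : R[i] := (z - w) / (1 - z^* * w).

Lemma mobius_den_neq0 z w : normc z < 1 -> normc w <= 1 -> 1 - z^* * w != 0.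
Proof.
move=> z1 w1; apply: (@subc_neq0 (normc z)); last by rewrite normc1.
by rewrite normcM normc_conj ler_piMr ?normc_ge0.
Qed.

Lemma mobius_normc z w : normc z < 1 -> normc w <= 1 -> normc (mobius z w) <= 1.
Proof.
move=> z1 w1; rewrite normcM normcV.
have D0 : 0 < normc (1 - z^* * w) by rewrite normc_gt0 mobius_den_neq0.
rewrite ler_pdivrMr // mul1r -(@ler_pXn2r _ 2) ?nnegrE ?normc_ge0 //.
have := sqr_ge0 (normc z); have := sqr_ge0 (normc w).
have : normc z ^+ 2 <= 1 by rewrite expr_le1 ?normc_ge0 // ltW.
have : normc w ^+ 2 <= 1 by rewrite expr_le1 ?normc_ge0.
rewrite !normc_sqr; case: z {z1 D0} => a b; case: w {w1} => c d /=.
by move=> h1 h2 _ _; nra.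
Qed.

Lemma mobius_normc1 z w : normc z < 1 -> normc w = 1 -> normc (mobius z w) = 1.
Proof.
move=> z1 w1; rewrite normcM normcV.
have D0 : 0 < normc (1 - z^* * w) by rewrite normc_gt0 mobius_den_neq0 ?w1.
apply: (mulIf (lt0r_neq0 D0)); rewrite mulfVK ?lt0r_neq0 // mul1r.
have -> : 1 - z^* * w = w * (w^* - z^*).
  by rewrite mulrBr mulcJ_normc w1 expr1n (mulrC w).
by rewrite normcM w1 mul1r -rmorphB normc_conj -normcN opprB.
Qed.

(** The mean value property of [F] composed with the involution of the disk
    exchanging [z] and the origin. *)
Lemma maximum_principle F (B : R) :
  (forall z, normc z <= 1 -> cdiff F z) ->
  (forall z, normc z = 1 -> normc (F z) <= B) ->
  forall z, normc z < 1 -> normc (F z) <= B.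
Proof.
move=> dF FB z z1.
(* This factor makes the value at the center equal to [normc (F z) ^+ 2], so that
   the mean value property of real parts controls the modulus. *)
pose k := (F z)^*.
have dG w : normc (w - 0) <= 1 -> cdiff (fun w => k * F (mobius z w)) w.
  rewrite subr0 => w1; apply: cdiffM; first exact: cdiff_cst.
  apply: (@cdiff_comp _ F (mobius z)); last exact/dF/mobius_normc.
  apply: cdiffM; first by apply: cdiffB; [exact: cdiff_cst|exact: cdiff_id].
  apply: cdiffV; first exact: mobius_den_neq0.
  apply: cdiffB; first exact: cdiff_cst.
  by apply: cdiffM; [exact: cdiff_cst|exact: cdiff_id].
have := mean_value ler01 dG.
have -> : mobius z 0 = z by rewrite /mobius mulr0 !subr0 divr1.
rewrite mulrC mulcJ_normc /= => meanE.
have B0 : 0 <= B by apply: le_trans (FB 1 (normc1 _)); exact: normc_ge0.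
have [->|n0] := eqVneq (normc (F z)) 0; first by [].
have n_gt0 : 0 < normc (F z) by rewrite lt_neqAle eq_sym n0 normc_ge0.
rewrite -(ler_pM2l n_gt0) -expr2 -meanE -[leRHS]mean_cst.
have cG : ccont (fun t => k * F (mobius z (0 + 1%:C * expi t))).
  apply: (@ccont_cdiff _ (fun w => k * F (mobius z w))) => [t|].
    by apply: dG; rewrite subr0 add0r mul1r normc_expi.
  apply: ccontD; first exact: ccont_cst.
  by apply: ccontM; [exact: ccont_cst|exact: ccont_expi].
apply: le_mean => [||t]; [exact: (proj1 cG)|exact: continuous_cstR|].
apply: le_trans (ler_norm _) _; apply: le_trans (Re_le_normc _) _.
rewrite normcM normc_conj ler_pM2l //; apply: FB; apply: mobius_normc1 => //.
by rewrite add0r mul1r normc_expi.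
Qed.

Lemma expi_surj z : normc z = 1 -> exists2 t, 0 <= t <= 2 * pi & z = expi t.
Proof.
move=> z1; have := normc_sqr z; rewrite z1 expr1n.
case: z {z1} => x y /= xy.
have x1 : -1 <= x <= 1 by have y2 := sqr_ge0 y; apply/andP; split; nra.
have sE : sin (acos x) = `|y|.
  by rewrite sin_acos // xy addrC addKr sqrtr_sqr.
have p0 := @pi_gt0 R; have a0 := acos_ge0 x1; have ap := acos_lepi x1.
have [y0|y0] := leP 0 y.
  exists (acos x); first by apply/andP; split; lra.
  by rewrite /expi acosK ?in_itv // sE ger0_norm.
exists (2 * pi - acos x); first by apply/andP; split; lra.
rewrite /expi mulr_natl cosB sinB cos2pi sin2pi !mul0r !mul1r addr0 sub0r.
by rewrite acosK ?in_itv // sE ltr0_norm // opprK.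
Qed.

End MaximumPrinciple.

(** * Poisson and Herglotz integrals *)

Section Herglotz.
Context {R : realType}.
Implicit Types (z w : R[i]) (u : R -> R).

Definition hkernel z (t : R) : R[i] := (expi t + z) / (expi t - z).

(** The holomorphic function in the disk whose real part is the Poisson integral
    of [u] and whose value at the origin is real. *)
Definition herglotz u z : R[i] := cmean (fun t => hkernel z t * (u t)%:C).

Definition herglotz_derive u z : R[i] :=
  cmean (fun t => 2 * expi t / (expi t - z) ^+ 2 * (u t)%:C).

Definition poisson z (t : R) : R := (1 - normc z ^+ 2) / normc (expi t - z) ^+ 2.

Lemma expi_sub_neq0 z (t : R) : normc z < 1 -> expi t - z != 0.
Proof. by move=> z1; apply: (@subc_neq0 _ (normc z)); rewrite ?normc_expi. Qed.

Lemma expi_sub_ge z (t : R) : 1 - normc z <= normc (expi t - z).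
Proof.
rewrite lerBlDr -(@normc_expi R t).
by apply: le_trans (normcD _ _); rewrite subrK.
Qed.

Lemma ccont_inv_expi_sub z : normc z < 1 -> ccont (fun t => (expi t - z)^-1).
Proof.
move=> z1; apply: (@ccont_cdiff _ (fun w => (w - z)^-1)) => [t|]; last exact: ccont_expi.
apply: cdiffV; first exact: expi_sub_neq0.
by apply: cdiffB; [exact: cdiff_id|exact: cdiff_cst].
Qed.

Lemma ccont_hkernel z : normc z < 1 -> ccont (hkernel z).
Proof.
move=> z1; apply: ccontM; last exact: ccont_inv_expi_sub.
by apply: ccontD; [exact: ccont_expi|exact: ccont_cst].
Qed.

Lemma Re_div z w : Re (z / w) = (Re z * Re w + Im z * Im w) / normc w ^+ 2.
Proof. by rewrite normc_sqr; case: z w => [a b] [c d] /=; ring. Qed.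

Lemma Re_hkernel z (t : R) : Re (hkernel z t) = poisson z t.
Proof.
rewrite /hkernel Re_div /poisson; congr (_ / _).
have := @normc_expi R t; have := @normc_sqr R (expi t).
rewrite (normc_sqr z) => + h; rewrite h; case: z => a b; rewrite /expi /= expr1n => h1.
by rewrite h1; ring.
Qed.

Lemma poisson_ge0 z (t : R) : normc z < 1 -> 0 <= poisson z t.
Proof.
move=> z1; rewrite divr_ge0 ?sqr_ge0 // subr_ge0 expr_le1 ?normc_ge0 //.
exact: ltW.
Qed.

Lemma continuous_poisson z : normc z < 1 -> continuous (poisson z).
Proof.
move=> z1; have [+ _] := ccont_hkernel z1.
by under [X in continuous X -> _]eq_fun do rewrite Re_hkernel.
Qed.

Lemma Re_herglotz u z : Re (herglotz u z) = mean (fun t => poisson z t * u t).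
Proof.
transitivity (mean (fun t => Re (hkernel z t * (u t)%:C))) => //.
by apply: eq_mean => t; rewrite Re_mul /= mulr0 subr0 Re_hkernel.
Qed.

Lemma Re_herglotzZ (k : R) (u : R -> R) z : continuous u -> normc z < 1 ->
  Re (herglotz (fun t => k * u t) z) = k * Re (herglotz u z).
Proof.
move=> uc z1; rewrite !Re_herglotz -meanZ; last first.
  by apply: continuousMR => //; exact: continuous_poisson.
by apply: eq_mean => t; ring.
Qed.

(** The complex conjugate of the kernel at [expi t] is the value at [expi t] of
    [(1 + z^* * w) / (1 - z^* * w)], which is holomorphic in [w] on the closed
    disk and equals 1 at the origin. *)
Lemma mean_poisson z : normc z < 1 -> mean (poisson z) = 1.
Proof.
move=> z1.
pose F (w : R[i]) : R[i] := (1 + z^* * w) / (1 - z^* * w).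
have dF w : normc (w - 0) <= 1 -> cdiff F w.
  rewrite subr0 => w1; have dM : cdiff (fun w => z^* * w) w.
    by apply: cdiffM; [exact: cdiff_cst|exact: cdiff_id].
  have dN : cdiff (fun w => 1 + z^* * w) w := cdiffD (@cdiff_cst _ 1 w) dM.
  have dD : cdiff (fun w => 1 - z^* * w) w := cdiffB (@cdiff_cst _ 1 w) dM.
  have dV : cdiff (fun w => (1 - z^* * w)^-1) w.
    by apply: cdiffV dD; exact: mobius_den_neq0.
  exact: (cdiffM dN dV).
have := mean_value ler01 dF.
rewrite {2}/F mulr0 addr0 subr0 divr1 /= => <-.
apply: eq_mean => t; rewrite -Re_hkernel add0r mul1r.
have e1 : expi t * (expi t)^* = 1 by rewrite mulcJ_normc normc_expi expr1n.
have -> : F (expi t) = (hkernel z t)^*.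
  have n0 : (expi t - z)^* != 0 by rewrite conjc_eq0 expi_sub_neq0.
  have d0 : 1 - z^* * expi t != 0 by rewrite mobius_den_neq0 ?normc_expi.
  rewrite /F /hkernel rmorphM fmorphV /= .
  apply/eqP; rewrite eqr_div //; apply/eqP; rewrite !rmorphD rmorphN /=.
  have alg (a b c : R[i]) : a * b = 1 -> (1 + c * a) * (b - c) = (b + c) * (1 - c * a).
    move=> ab; have -> : (1 + c * a) * (b - c) = b - c + c * (a * b) - c * c * a by ring.
    have -> : (b + c) * (1 - c * a) = b + c - c * (a * b) - c * c * a by ring.
    by rewrite ab; ring.
  exact: alg.
by case: (hkernel z t).
Qed.

(** An exact identity rather than a Taylor estimate: it bounds the remainder
    uniformly in the density [u] in terms of its total mass. *)
Lemma herglotz_kernel_remainder z w (t : R) : normc z < 1 -> normc w < 1 ->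
  hkernel w t - hkernel z t - (w - z) * (2 * expi t / (expi t - z) ^+ 2) =
  2 * expi t * (w - z) ^+ 2 / ((expi t - w) * (expi t - z) ^+ 2).
Proof.
move=> z1 w1; rewrite /hkernel.
have := expi_sub_neq0 t z1; have := expi_sub_neq0 t w1.
move: (expi t) => e ew ez; field; by rewrite ew ez.
Qed.

Lemma ccont_herglotz_integrand (k : R -> R[i]) u : ccont k -> continuous u ->
  ccont (fun t => k t * (u t)%:C).
Proof. by move=> kc uc; apply: ccontM => //; exact: ccont_real. Qed.

Lemma ccont_hkernel_derive z : normc z < 1 ->
  ccont (fun t => 2 * expi t / (expi t - z) ^+ 2).
Proof.
move=> z1; apply: ccontM; first by apply: ccontM; [exact: ccont_cst|exact: ccont_expi].
under [X in ccont X]eq_fun do rewrite expr2 invfM.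
by apply: ccontM; exact: ccont_inv_expi_sub.
Qed.

(** The constant depends on the density only through its mass, which is what
    lets holomorphy pass to limits of such integrals. *)
Lemma herglotz_remainder u (rho : R) z w : continuous u -> rho < 1 ->
  normc z <= rho -> normc w <= rho ->
  normc (herglotz u w - herglotz u z - herglotz_derive u z * (w - z)) <=
  4 / (1 - rho) ^+ 3 * mean (fun t => `|u t|) * normc (w - z) ^+ 2.
Proof.
move=> uc rho1 zr wr.
have z1 := le_lt_trans zr rho1; have w1 := le_lt_trans wr rho1.
have cw := ccont_herglotz_integrand (ccont_hkernel w1) uc.
have cz := ccont_herglotz_integrand (ccont_hkernel z1) uc.
have cd := ccont_herglotz_integrand (ccont_hkernel_derive z1) uc.
have czd : ccont (fun t => (w - z) * (2 * expi t / (expi t - z) ^+ 2 * (u t)%:C)).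
  by apply: ccontM => //; exact: ccont_cst.
rewrite /herglotz /herglotz_derive mulrC -cmeanZ // -cmeanB // -cmeanB //; last first.
  exact: ccontB.
have -> : 4 / (1 - rho) ^+ 3 * mean (fun t => `|u t|) * normc (w - z) ^+ 2 =
   2 * ((2 / (1 - rho) ^+ 3 * normc (w - z) ^+ 2) * mean (fun t => `|u t|)) by ring.
apply: normc_cmean => [||t].
- by apply: ccontB czd; exact: ccontB.
- exact: continuous_normR.
have -> : hkernel w t * (u t)%:C - hkernel z t * (u t)%:C -
    (w - z) * (2 * expi t / (expi t - z) ^+ 2 * (u t)%:C) =
    (hkernel w t - hkernel z t - (w - z) * (2 * expi t / (expi t - z) ^+ 2)) * (u t)%:C.
  by ring.
rewrite normcM normc_real ler_wpM2r //.
rewrite herglotz_kernel_remainder // !expr2 !normcM !normcV !normcM normc_expi mulr1.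
have -> : normc (2 : R[i]) = 2 
  by rewrite -[2]/(2%:R) -(rmorph_nat (@real_complex R)) normc_real ger0_norm.
rewrite -!expr2 mulrAC ler_wpM2r ?sqr_ge0 // ler_wpM2l //.
have r0 : 0 < 1 - rho by rewrite subr_gt0.
have ez := expi_sub_ge z t; have ew := expi_sub_ge w t.
have rz : 1 - rho <= normc (expi t - z) by lra.
have rw : 1 - rho <= normc (expi t - w) by lra.
have z0 := lt_le_trans r0 rz; have w0 := lt_le_trans r0 rw.
rewrite lef_pV2 ?posrE ?mulr_gt0 ?exprn_gt0 //.
rewrite exprS ler_pM ?exprn_ge0 ?(ltW r0) // lerXn2r ?nnegrE ?(ltW r0) ?(ltW z0) //.
Qed.

Lemma cdiff_of_remainder (F : R[i] -> R[i]) d z (rho K : R) : normc z < rho ->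
  (forall w, normc w <= rho ->
     normc (F w - F z - d * (w - z)) <= K * normc (w - z) ^+ 2) ->
  cdiff F z.
Proof.
move=> zr FK; apply/derivable_cderivP; exists d => e e0.
have K1 : 0 < `|K| + 1 by rewrite ltr_wpDl.
exists (Num.min (rho - normc z) (e / (`|K| + 1))).
  by rewrite lt_min subr_gt0 zr divr_gt0.
move=> h; rewrite lt_min => /andP[hr]; rewrite ltr_pdivlMr // => hK.
have zh : z + h - z = h by rewrite addrAC subrr add0r.
have := FK (z + h); rewrite zh => FKh.
apply: le_trans (FKh _) _.
  by rewrite addrC; apply: le_trans (normcD _ _) _; lra.
rewrite expr2 mulrA ler_wpM2r ?normc_ge0 //.
apply: le_trans (ltW hK); rewrite mulrC ler_wpM2l ?normc_ge0 //.
by have := ler_norm K; lra.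
Qed.

Lemma cdiff_herglotz u z : continuous u -> normc z < 1 -> cdiff (herglotz u) z.
Proof.
move=> uc z1; have zr : normc z < (1 + normc z) / 2 by lra.
apply: (cdiff_of_remainder zr) => w wr.
by apply: (herglotz_remainder uc _ (ltW zr) wr); lra.
Qed.

Lemma poisson0 (t : R) : poisson 0 t = 1.
Proof. by rewrite /poisson normc0 subr0 normc_expi expr0n subr0 expr1n divr1. Qed.

Lemma Re_herglotz0 u : Re (herglotz u 0) = mean u.
Proof. by rewrite Re_herglotz; apply: eq_mean => t; rewrite poisson0 mul1r. Qed.

Lemma normc_herglotz u z : continuous u -> normc z < 1 ->
  normc (herglotz u z) <= 4 / (1 - normc z) * mean (fun t => `|u t|).
Proof.
move=> uc z1; have z0 : 0 < 1 - normc z by rewrite subr_gt0.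
have -> : 4 / (1 - normc z) * mean (fun t => `|u t|) =
   2 * (2 / (1 - normc z) * mean (fun t => `|u t|)) by ring.
apply: normc_cmean => [||t].
- by apply: ccont_herglotz_integrand => //; exact: ccont_hkernel.
- exact: continuous_normR.
rewrite normcM normc_real ler_wpM2r // normcM normcV ler_pM ?invr_ge0 ?normc_ge0 //.
  by apply: le_trans (normcD _ _) _; rewrite normc_expi; lra.
have ez := expi_sub_ge z t.
by rewrite lef_pV2 ?posrE // (lt_le_trans z0).
Qed.

Lemma normc_herglotz_derive u z : continuous u -> normc z < 1 ->
  normc (herglotz_derive u z) <= 4 / (1 - normc z) ^+ 2 * mean (fun t => `|u t|).
Proof.
move=> uc z1; have z0 : 0 < 1 - normc z by rewrite subr_gt0.
have -> : 4 / (1 - normc z) ^+ 2 * mean (fun t => `|u t|) =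
   2 * (2 / (1 - normc z) ^+ 2 * mean (fun t => `|u t|)) by ring.
apply: normc_cmean => [||t].
- by apply: ccont_herglotz_integrand => //; exact: ccont_hkernel_derive.
- exact: continuous_normR.
rewrite normcM normc_real ler_wpM2r // normcM normcV ler_pM ?invr_ge0 ?normc_ge0 //.
  rewrite normcM normc_expi mulr1 -[2]/(2%:R) -(rmorph_nat (@real_complex R)).
  by rewrite normc_real ger0_norm.
have ez := expi_sub_ge z t; have e0 := lt_le_trans z0 ez.
rewrite expr2 normcM -expr2 lef_pV2 ?posrE ?exprn_gt0 //.
by rewrite lerXn2r ?nnegrE ?(ltW z0) ?normc_ge0.
Qed.

(** The mass which the Poisson kernel of [z] puts away from [b] is controlled
    by its second moment, which is explicit because
    [poisson z t * normc (expi t - z) ^+ 2] does not depend on [t]. *)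
Lemma herglotz_ge_quadratic u (b z : R[i]) (L C : R) : continuous u -> 0 <= C ->
  (forall t, L - C * normc (expi t - b) ^+ 2 <= u t) -> normc z < 1 ->
  L - 2 * C * (1 - normc z ^+ 2) - 2 * C * normc (z - b) ^+ 2 <= Re (herglotz u z).
Proof.
move=> uc C0 uL z1; rewrite Re_herglotz.
have pc := continuous_poisson z1.
pose k := L - 2 * C * normc (z - b) ^+ 2; pose m := 2 * C * (1 - normc z ^+ 2).
have -> : L - 2 * C * (1 - normc z ^+ 2) - 2 * C * normc (z - b) ^+ 2 =
          mean (fun t => k * poisson z t - m).
  rewrite meanB; [|exact: continuousZR|exact: continuous_cstR].
  by rewrite meanZ // mean_poisson // mean_cst /k /m; ring.
apply: le_mean => [||t].
- by apply: continuousBR; [exact: continuousZR|exact: continuous_cstR].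
- exact: continuousMR.
have p0 := poisson_ge0 t z1.
have mE : m = poisson z t * (2 * C * normc (expi t - z) ^+ 2).
  rewrite /m /poisson; field.
  by rewrite gt_eqF // normc_gt0 expi_sub_neq0.
rewrite mE mulrC -mulrBr; apply: ler_wpM2l => //; apply: le_trans (uL t).
have tri : normc (expi t - b) ^+ 2 <= 2 * normc (z - b) ^+ 2 + 2 * normc (expi t - z) ^+ 2.
  have h : normc (expi t - b) <= normc (expi t - z) + normc (z - b).
    by apply: le_trans (normcD _ _); rewrite addrA subrK.
  have h0 := normc_ge0 (expi t - b); have h1 := normc_ge0 (expi t - z).
  have h2 := normc_ge0 (z - b).
  apply: (@le_trans _ _ ((normc (expi t - z) + normc (z - b)) ^+ 2)).
    by rewrite lerXn2r ?nnegrE ?addr_ge0.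
  have := sqr_ge0 (normc (expi t - z) - normc (z - b)); nra.
have := ler_wpM2l C0 tri; rewrite /k; lra.
Qed.

End Herglotz.

(** * The Poisson majorant of the logarithm of a modulus *)

Section LogMajorant.
Context {R : realType}.
Implicit Types (z w b : R[i]) (u : R -> R) (F : R[i] -> R[i]).

Lemma circle_bounded u : continuous u ->
  exists2 K : R, 0 <= K & forall t : R, 0 <= t <= 2 * pi -> `|u t| <= K.
Proof.
move=> uc; have nc := continuous_normR uc.
have [c _ cP] := EVT_max (ltW (@twopi_gt0 R)) (continuous_subspaceT nc).
by exists `|u c| => // t tP; apply: cP; rewrite in_itv.
Qed.

Definition log_max F (kappa : R) w : R := ln (Num.max (normc (F w)) kappa).

Lemma log_max_pos F (kappa : R) w : 0 < kappa -> 0 < Num.max (normc (F w)) kappa.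
Proof. by move=> k0; rewrite lt_max k0 orbT. Qed.

(** From [ln (1 + x) <= x], the denominators being at least [kappa]. *)
Lemma log_max_lipschitz1 F (kappa : R) w w' : 0 < kappa ->
  log_max F kappa w - log_max F kappa w' <= normc (F w - F w') / kappa.
Proof.
move=> k0; have p := log_max_pos F w k0; have p' := log_max_pos F w' k0.
rewrite /log_max -ln_div //.
set x := Num.max _ _ in p *; set y := Num.max _ _ in p' *.
have ky : kappa <= y by rewrite le_max lexx orbT.
have d0 := normc_ge0 (F w - F w').
have xy : x <= y + normc (F w - F w').
  rewrite ge_max; apply/andP; split; last lra.
  have : normc (F w') <= y by rewrite le_max lexx.
  have : normc (F w) <= normc (F w - F w') + normc (F w').
    by apply: le_trans (normcD _ _); rewrite subrK.
  lra.
have -> : x / y = 1 + (x - y) / y by field; rewrite gt_eqF.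
apply: le_trans (le_ln1Dx _) _.
  have -> : (x - y) / y = x / y - 1 by field; rewrite gt_eqF.
  by have := divr_gt0 p p'; lra.
apply: (@le_trans _ _ (normc (F w - F w') / y)).
  by apply: ler_wpM2r; [rewrite invr_ge0 ltW|lra].
by apply: ler_wpM2l => //; rewrite lef_pV2 // posrE.
Qed.

Lemma log_max_lipschitz F (kappa : R) w w' : 0 < kappa ->
  `|log_max F kappa w - log_max F kappa w'| <= normc (F w - F w') / kappa.
Proof.
move=> k0; rewrite ler_norml log_max_lipschitz1 // andbT lerNl opprB.
by rewrite -(normcN (_ - _)) opprB log_max_lipschitz1.
Qed.

Lemma continuous_log_max F (kappa : R) (v : R -> R[i]) : 0 < kappa ->
  ccont (fun t => F (v t)) -> continuous (fun t => log_max F kappa (v t)).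
Proof.
move=> k0 /ccontP Fc t; apply/cvgrPdist_lt => e e0.
have [d d0 dP] := Fc t (e * kappa) (mulr_gt0 e0 k0).
apply/nbhs_normP; exists d => //= s; rewrite /ball_ /= distrC => /dP h.
rewrite distrC; apply: le_lt_trans (log_max_lipschitz _ _ _ k0) _.
by rewrite ltr_pdivrMr.
Qed.

(** Near a boundary point [b] the Poisson integral of a continuous function is
    close to its value at [b]. On the circle the function is at least its value at
    [b] up to [e / 3] and a multiple of the squared distance to [b]: where the
    function is far from its value at [b], so is the point, and the quadratic term
    absorbs the oscillation. The Poisson integral of the quadratic term is then
    handled by [herglotz_ge_quadratic]. *)
Lemma boundary_majorant F (kappa : R) b (e : R) : 0 < kappa ->
  (forall z, normc z <= 1 -> cdiff F z) -> normc b = 1 -> 0 < e ->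
  exists2 delta, 0 < delta & forall z, normc z < 1 -> normc (z - b) < delta ->
    log_max F kappa z <= Re (herglotz (fun t => log_max F kappa (expi t)) z) + e.
Proof.
move=> k0 dF b1 e0; set u := fun t : R => _; set m := log_max F kappa.
have uc : continuous u.
  apply: continuous_log_max => //; apply: ccont_cdiff (@ccont_expi R) => t.
  by apply: dF; rewrite normc_expi.
have [K K0 KP] := circle_bounded uc.
have mK w : normc w = 1 -> `|m w| <= K by move=> /expi_surj [t /KP h ->].
have [d d0 dP] : exists2 d, 0 < d & forall w, normc (w - b) < d -> `|m w - m b| <= e / 3.
  have b1' : normc b <= 1 by rewrite b1.
  have ek : 0 < e / 3 * kappa by rewrite mulr_gt0 // divr_gt0.
  have [d d0 dP] := cdiff_continuous (dF b b1') ek.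
  exists d => // w /dP h; apply: le_trans (log_max_lipschitz _ _ _ k0) _.
  by rewrite ler_pdivrMr // ltW.
pose C := 2 * K / d ^+ 2.
have C0 : 0 <= C by rewrite divr_ge0 ?sqr_ge0 // mulr_ge0.
have uL t : m b - e / 3 - C * normc (expi t - b) ^+ 2 <= u t.
  have [near|far] := ltP (normc (expi t - b)) d.
    have := dP _ near; rewrite ler_norml -/m => /andP[h _].
    have : 0 <= C * normc (expi t - b) ^+ 2 by rewrite mulr_ge0 ?sqr_ge0.
    by move: h; rewrite /u -/m; lra.
  have : 2 * K <= C * normc (expi t - b) ^+ 2.
    rewrite /C mulrAC ler_pdivlMr ?exprn_gt0 // ler_wpM2l ?mulr_ge0 //.
    by rewrite lerXn2r ?nnegrE ?normc_ge0 // ltW.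
  have := mK _ b1; have := mK _ (normc_expi t); rewrite !ler_norml => /andP[h _] /andP[_ h'].
  by rewrite /u -/m; lra.
(* At distance [x <= 1] from [b] the two quadratic errors add up to at most
   [6 * C * x], to be kept below [e / 3]. *)
exists (Num.min (Num.min 1 d) (e / (18 * (C + 1)))).
  by rewrite !lt_min ltr01 d0 divr_gt0 // mulr_gt0 // ltr_wpDl.
move=> z z1; rewrite !lt_min => /andP[/andP[n1 nd]].
rewrite ltr_pdivlMr; last by rewrite mulr_gt0 // ltr_wpDl.
move=> ne; have := herglotz_ge_quadratic uc C0 uL z1.
have := dP _ nd; rewrite ler_norml => /andP[_ mz].
have n0 := normc_ge0 (z - b); have z0 := normc_ge0 z.
have sq1 : normc (z - b) ^+ 2 <= normc (z - b) by rewrite expr2 ler_piMl // ltW.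
have zb : 1 - normc z <= normc (z - b).
  rewrite lerBlDr -b1 -(normcN (z - b)) opprB.
  by apply: le_trans (normcD _ _); rewrite subrK.
have sq2 : 1 - normc z ^+ 2 <= 2 * normc (z - b) by nra.
have c1 : 2 * C * (1 - normc z ^+ 2) <= 2 * C * (2 * normc (z - b)).
  by rewrite ler_wpM2l // mulr_ge0.
have c2 : 2 * C * normc (z - b) ^+ 2 <= 2 * C * normc (z - b).
  by rewrite ler_wpM2l // mulr_ge0.
lra.
Qed.

(** Compactness of the circle, parametrized by a segment. *)
Lemma uniform_boundary_majorant F (kappa e : R) : 0 < kappa ->
  (forall z, normc z <= 1 -> cdiff F z) -> 0 < e ->
  exists2 delta, 0 < delta & forall z, 1 - delta <= normc z < 1 ->
    log_max F kappa z <= Re (herglotz (fun t => log_max F kappa (expi t)) z) + e.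
Proof.
move=> k0 dF e0; set H := herglotz _.
pose P (delta t : R) := forall rho : R, 0 < rho -> 1 - delta <= rho < 1 ->
  log_max F kappa (rho%:C * expi t) <= Re (H (rho%:C * expi t)) + e.
have cpt : near_covering (`[0, 2 * pi]%classic : set R).
  by apply/compact_near_coveringP; exact: segment_compact.
have {}cpt : \forall delta \near (0 : R)^'+, `[0, 2 * pi]%classic `<=` P delta.
  apply: cpt => x _.
  have [d d0 dP] := boundary_majorant k0 dF (normc_expi x) e0.
  have d2 : 0 < d / 2 by rewrite divr_gt0.
  have [eta eta0 etaP] := (proj1 (ccontP _) (@ccont_expi R)) x _ d2.
  exists ([set t | `|t - x| < eta], [set delta | delta < d / 2]) => /=.
    split; last exact: nbhs_right_lt.
    by apply/nbhs_normP; exists eta => //= t; rewrite /ball_ /= distrC.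
  move=> [t delta] /= [/etaP tx dd] rho rho0 /andP[rho1 rho1'].
  apply: dP; first by rewrite normcM normc_expi mulr1 normc_real gtr0_norm.
  have -> : rho%:C * expi t - expi x = (rho%:C - 1) * expi t + (expi t - expi x) by ring.
  apply: le_lt_trans (normcD _ _) _; rewrite normcM normc_expi mulr1.
  rewrite -(rmorphB (@real_complex R)) normc_real ler0_norm; lra.
have [delta [delta0 deltaP]] : exists delta : R, 0 < delta /\
    `[0, 2 * pi]%classic `<=` P delta.
  have cpt2 : \forall delta \near (0 : R)^'+,
      (`[0, 2 * pi]%classic `<=` P delta) /\ 0 < delta.
    by apply: filterI => //; exact: nbhs_right_gt.
  have [delta [h1 h2]] := @filter_ex _ _ (at_right_proper_filter (0 : R)) _ cpt2.
  by exists delta.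
exists (Num.min delta (1/2)); first by rewrite lt_min delta0 divr_gt0.
move=> z /andP[z0 z1].
have mh : Num.min delta (1/2) <= 1/2 by rewrite ge_min lexx orbT.
have md : Num.min delta (1/2) <= delta by rewrite ge_min lexx.
have n0 : 0 < normc z by lra.
have [|t tP zE] := @expi_surj R (z / (normc z)%:C).
  by rewrite normcM normcV normc_real gtr0_norm // divff // gt_eqF.
have -> : z = (normc z)%:C * expi t.
  by rewrite -zE mulrC divfK // (fmorph_eq0 (@real_complex R)) gt_eqF.
by apply: deltaP; rewrite /= ?in_itv //; lra.
Qed.

(** [log |F|] lies below the Poisson integral of the continuous majorant
    [log (max |F| kappa)] of its boundary values: divide [F] by the outer
    function with that logarithmic modulus and apply the maximum principle. *)
Lemma log_poisson_majorant F (kappa : R) z : 0 < kappa ->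
  (forall z, normc z <= 1 -> cdiff F z) -> normc z < 1 ->
  normc (F z) <= expR (Re (herglotz (fun t => log_max F kappa (expi t)) z)).
Proof.
move=> k0 dF z1; set u := fun t : R => _.
have uc : continuous u.
  apply: continuous_log_max => //; apply: ccont_cdiff (@ccont_expi R) => t.
  by apply: dF; rewrite normc_expi.
have bound e : 0 < e -> normc (F z) <= expR e * expR (Re (herglotz u z)).
  move=> e0; have [delta delta0 deltaP] := uniform_boundary_majorant k0 dF e0.
  (* A circle outside [z] and inside the annulus where the boundary estimate holds. *)
  pose rho := Num.max ((1 + normc z) / 2) (1 - Num.min delta (1/2)).
  have [rhoz rhod rho1] : [/\ normc z < rho, 1 - delta <= rho & rho < 1].
    split.
    - by rewrite lt_max; apply/orP; left; lra.
    - by rewrite le_max; apply/orP; right; rewrite lerB // ge_min lexx.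
    - rewrite gt_max; apply/andP; split; first lra.
      by rewrite ltrBlDr ltrDl lt_min delta0 divr_gt0.
  have rho0 : 0 < rho by apply: le_lt_trans rhoz; exact: normc_ge0.
  have nrho : normc rho%:C = rho by rewrite normc_real gtr0_norm.
  have rhoN : rho%:C != 0 :> R[i] by rewrite (fmorph_eq0 (@real_complex R)) gt_eqF.
  pose f (w : R[i]) : R[i] := F (rho%:C * w) * expC (- herglotz u (rho%:C * w)).
  have df w : normc w <= 1 -> cdiff f w.
    move=> w1; have rw : normc (rho%:C * w) < 1.
      by rewrite normcM nrho; apply: le_lt_trans rho1; rewrite ler_piMr // ltW.
    have dm : cdiff (fun w => rho%:C * w) w.
      by apply: cdiffM; [exact: cdiff_cst|exact: cdiff_id].
    have dH : cdiff (fun w => 0 - herglotz u (rho%:C * w)) w.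
      apply: cdiffB; first exact: cdiff_cst.
      exact: (cdiff_comp dm (cdiff_herglotz uc rw)).
    apply: cdiffM; first exact: (cdiff_comp dm (dF _ (ltW rw))).
    apply: (@cdiff_comp _ expC (fun w => - herglotz u (rho%:C * w))); last exact: cdiff_expC.
    by apply: eq_cdiff dH => w'; rewrite sub0r.
  have fB w : normc w = 1 -> normc (f w) <= expR e.
    move=> w1; have nw : normc (rho%:C * w) = rho by rewrite normcM nrho w1 mulr1.
    have := deltaP (rho%:C * w); rewrite nw rhod rho1 => /(_ isT).
    rewrite -/u => h; rewrite /f normcM normc_expC.
    apply: (@le_trans _ _ (expR (log_max F kappa (rho%:C * w)) *
      expR (Re (- herglotz u (rho%:C * w))))).
      rewrite ler_wpM2r ?expR_ge0 // /log_max lnK ?posrE ?log_max_pos //.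
      by rewrite le_max lexx.
    by rewrite -expRD ler_expR Re_opp; lra.
  have := maximum_principle df fB (z := z / rho%:C).
  rewrite normcM normcV nrho ltr_pdivrMr // mul1r => /(_ rhoz).
  have -> : f (z / rho%:C) = F z * expC (- herglotz u z) by rewrite /f (mulrC rho%:C) divfK.
  rewrite normcM normc_expC Re_opp expRN.
  by rewrite ler_pdivrMr ?expR_gt0.
have [->|n0] := eqVneq (normc (F z)) 0; first exact: expR_ge0.
have n_gt0 : 0 < normc (F z) by rewrite lt_neqAle eq_sym n0 normc_ge0.
rewrite -(lnK (n_gt0 : _ \is Num.pos)) ler_expR.
apply/ler_addgt0Pl => e /bound.
by rewrite -expRD -{1}(lnK (n_gt0 : _ \is Num.pos)) ler_expR.
Qed.

End LogMajorant.

(** * Growth functions of lower type *)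

Section GrowthFunctions.
Context {R : realType} (Phi : R -> R) (hPhi : lower_type_growth_function Phi).
Implicit Types (s t x y : R).

Let growth := ltgf_growth hPhi.

Lemma ltgf_ge0 x : 0 <= x -> 0 <= Phi x. Proof. exact: growth_ge0. Qed.

Lemma ltgf_le x y : 0 <= x -> x <= y -> Phi x <= Phi y.
Proof. exact: growth_nondecreasing. Qed.

Lemma ltgf_continuous_at (x e : R) : 0 <= x -> 0 < e -> exists2 delta, 0 < delta &
  forall y, 0 <= y -> `|y - x| < delta -> `|Phi y - Phi x| < e.
Proof.
move=> x0 e0; have xin : (`[0, +oo[%classic : set R) x by rewrite /= in_itv /= x0.
move/subspace_continuousP : (ltgf_continuous hPhi) => /(_ x xin) /cvgrPdist_lt /(_ _ e0).
rewrite near_withinE => /nbhs_normP [d /= d0 dP].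
exists d => // y y0 yd; rewrite distrC; apply: dP; last by rewrite /= in_itv /= y0.
by rewrite /ball_ /= distrC.
Qed.

Lemma continuous_ltgf (u : R -> R) : continuous u -> (forall t, 0 <= u t) ->
  continuous (fun t => Phi (u t)).
Proof.
move=> uc u0 t; apply/cvgrPdist_lt => e e0.
have [d d0 dP] := ltgf_continuous_at (u0 t) e0.
move/cvgrPdist_lt : (uc t) => /(_ _ d0); apply: filterS => s us.
by rewrite distrC; apply: dP => //; rewrite distrC.
Qed.

Lemma ltgf_surj t : 0 <= t -> exists2 x, 0 <= x & Phi x = t.
Proof.
move=> t0; have [b b0 bt] : exists2 b, 0 <= b & t <= Phi b.
  have /cvgryPge /(_ t) := growth_cvgy growth.
  move=> [M [_ MP]]; exists (Num.max 0 (M + 1)); first by rewrite le_max lexx.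
  by apply: MP; rewrite lt_max ltrDl ltr01 orbT.
have pc : {within `[0, b], continuous Phi}.
  apply: continuous_subspaceW (ltgf_continuous hPhi).
  by move=> x /=; rewrite !in_itv /= => /andP[-> _].
have [|c] := IVT b0 pc (v := t).
  by rewrite (growth_at0 growth) ge_min le_max t0 bt orbT.
by rewrite in_itv /= => /andP[c0 _] <-; exists c.
Qed.

Lemma ltgf_lt_inv x y : 0 <= x -> Phi x < Phi y -> 0 <= y -> x < y.
Proof.
move=> x0 xy y0; rewrite ltNge; apply: contraTN xy => /(ltgf_le y0).
by rewrite leNgt.
Qed.

Lemma growth_invK t : 0 <= t -> Phi (growth_inv Phi t) = t.
Proof.
move=> t0; apply: pinvK; rewrite inE.
by have [x x0 xt] := ltgf_surj t0; exists x => //=; rewrite in_itv /= x0.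
Qed.

Lemma ltgf_inj x y : 0 <= x -> 0 <= y -> Phi x = Phi y -> x = y.
Proof.
move=> x0 y0 xy; case: (ltgtP x y) => // h.
  by have := ltgf_increasing hPhi x0 h; rewrite xy ltxx.
by have := ltgf_increasing hPhi y0 h; rewrite xy ltxx.
Qed.

Lemma growth_inv_ge0 t : 0 <= t -> 0 <= growth_inv Phi t.
Proof.
move=> t0.
have inj : {in (`[0, +oo[%classic : set R) &, injective Phi}.
  by move=> x y; rewrite !inE /= !in_itv /= !andbT; exact: ltgf_inj.
have : `[0, +oo[%classic (growth_inv Phi t).
  rewrite -(injpinv_image (fun=> 0) inj); exists t => //.
  by have [x x0 xt] := ltgf_surj t0; exists x => //=; rewrite in_itv /= x0.
by rewrite /= in_itv /= andbT.
Qed.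

Lemma growth_inv_le s t : 0 <= s -> s <= t -> growth_inv Phi s <= growth_inv Phi t.
Proof.
move=> s0 st; have t0 := le_trans s0 st.
rewrite leNgt; apply/negP => /(ltgf_increasing hPhi (growth_inv_ge0 t0)).
by rewrite !growth_invK // ltNge st.
Qed.

Lemma ltgfK x : 0 <= x -> growth_inv Phi (Phi x) = x.
Proof.
by move=> x0; apply: ltgf_inj => //; rewrite ?growth_invK ?growth_inv_ge0 ?ltgf_ge0.
Qed.

Lemma growth_inv_gt0 t : 0 < t -> 0 < growth_inv Phi t.
Proof.
move=> t0; rewrite lt_neqAle growth_inv_ge0 ?ltW // andbT.
apply/eqP => h; have := growth_invK (ltW t0).
by rewrite -h (growth_at0 growth) => t0'; rewrite -t0' ltxx in t0.
Qed.

Lemma continuous_growth_inv (u : R -> R) : continuous u -> (forall t, 0 < u t) ->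
  continuous (fun t => growth_inv Phi (u t)).
Proof.
move=> uc u0 t; apply/cvgrPdist_lt => e e0.
set x := growth_inv Phi (u t).
have x0 : 0 < x by exact: growth_inv_gt0.
pose d := Num.min e x / 2.
have d0 : 0 < d by rewrite divr_gt0 // lt_min e0.
have de : d < e.
  have : Num.min e x <= e by rewrite ge_min lexx.
  by rewrite /d; lra.
have dx : 0 <= x - d.
  have : Num.min e x <= x by rewrite ge_min lexx orbT.
  by rewrite /d; lra.
have lo : Phi (x - d) < u t.
  by rewrite -(growth_invK (ltW (u0 t))); apply: (ltgf_increasing hPhi) => //; rewrite -/x; lra.
have hi : u t < Phi (x + d).
  rewrite -(growth_invK (ltW (u0 t))); apply: (ltgf_increasing hPhi); rewrite -/x; lra.
have eta0 : 0 < Num.min (u t - Phi (x - d)) (Phi (x + d) - u t).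
  by rewrite lt_min !subr_gt0 lo.
move/cvgrPdist_lt : (uc t) => /(_ _ eta0); apply: filterS => s.
rewrite lt_min !ltr_norml => /andP[/andP[h1 h2] /andP[h3 h4]].
have u0s := ltW (u0 s).
have l1 : x - d < growth_inv Phi (u s).
  by apply: ltgf_lt_inv => //; rewrite ?growth_invK ?growth_inv_ge0 //; lra.
have l2 : growth_inv Phi (u s) < x + d.
  by apply: ltgf_lt_inv; rewrite ?growth_invK ?growth_inv_ge0 //; lra.
by rewrite /= -/x; lra.
Qed.

(** Lower type trades a constant in front of [Phi] for one inside its argument,
    which is what a Luxemburg norm can absorb. *)
Lemma ltgf_scale (K : R) : 0 <= K -> exists2 lam, 1 <= lam &
  forall s, 0 <= s -> K * Phi (s / lam) <= Phi s.
Proof.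
move=> K0; have [p p0 [C C1 CP]] := ltgf_lower_type hPhi.
pose lam := (C * (K + 1)) `^ p^-1.
have CK : 1 <= C * (K + 1).
  by apply: (@le_trans _ _ (1 * (K + 1))); [lra|rewrite ler_wpM2r; lra].
have lam1 : 1 <= lam by rewrite -(powRr0 (C * (K + 1))) ler_powR // invr_ge0 ltW.
exists lam => // s s0; have lam0 : 0 < lam by lra.
have l01 : 0 <= lam^-1 <= 1 by rewrite invr_ge0 (ltW lam0) invf_le1.
have := CP s _ l01 s0.
have -> : lam^-1 `^ p = (C * (K + 1))^-1.
  rewrite -powR_inv1 ?ltW // -powRrM mulN1r powRN /lam -powRrM mulVf ?powRr1 //; lra.
move=> h; apply: le_trans (ler_wpM2l K0 h) _.
have P0 := ltgf_ge0 s0.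
have -> : C / (C * (K + 1)) = (K + 1)^-1.
  by field; apply/andP; split; rewrite gt_eqF //; lra.
by rewrite mulrA ler_piMl // ler_pdivrMr; lra.
Qed.

(** The slope inequality which replaces the convexity of [Phi \o expR]: the
    affine function of slope [Phi (expR x)] vanishing at [x] lies below a fixed
    multiple of [Phi \o expR]. *)
Lemma ltgf_slope : exists2 A : R, 0 < A &
  forall x y, Phi (expR x) * (y - x) <= A * Phi (expR y).
Proof.
have [p p0 [C C1 CP]] := ltgf_lower_type hPhi.
exists (C / p); first by rewrite divr_gt0 //; lra.
move=> x y; have Px := ltgf_ge0 (expR_ge0 x); have Py := ltgf_ge0 (expR_ge0 y).
have [yx|xy] := leP y x.
  apply: (@le_trans _ _ 0); first by rewrite mulr_ge0_le0 // subr_le0.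
  by rewrite mulr_ge0 // divr_ge0 ?(ltW p0) //; lra.
have d0 : 0 < y - x by rewrite subr_gt0.
have e01 : 0 <= expR (x - y) <= 1 by rewrite expR_ge0 /= -expR0 ler_expR; lra.
have := CP (expR y) _ e01 (expR_ge0 y).
rewrite -expRD addrC subrK -expRM => h.
apply: le_trans (ler_wpM2r (ltW d0) h) _.
have pE : expR ((x - y) * p) * ((y - x) * p) <= 1.
  have -> : expR ((x - y) * p) = (expR ((y - x) * p))^-1.
    by rewrite -expRN; congr expR; ring.
  rewrite mulrC ler_pdivrMr ?expR_gt0 // mul1r.
  by have := expR_ge1Dx ((y - x) * p); lra.
have -> : C * expR ((x - y) * p) * Phi (expR y) * (y - x) =
    C / p * Phi (expR y) * (expR ((x - y) * p) * ((y - x) * p)).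
  by field; rewrite gt_eqF.
by rewrite ler_piMr // mulr_ge0 // divr_ge0 ?(ltW p0) //; lra.
Qed.

(** A form of Jensen's inequality: integrate [ltgf_slope], with [x] one less than
    the Poisson integral of [u], against the Poisson kernel; the left-hand side
    becomes exactly [Phi (expR x)]. *)
Lemma ltgf_jensen : exists2 A : R, 0 < A &
  forall (u : R -> R) (z : R[i]), continuous u -> normc z < 1 ->
    Phi (expR (Re (herglotz u z) - 1)) <=
    A * Re (herglotz (fun t => Phi (expR (u t))) z).
Proof.
have [A A0 AP] := ltgf_slope; exists A => // u z uc z1.
set x := Re (herglotz u z) - 1.
have pc := continuous_poisson z1.
have Pc : continuous (fun t => Phi (expR (u t))).
  apply: continuous_ltgf => [t|t]; last exact: expR_ge0.
  by apply: continuous_comp; [exact: uc|exact: continuous_expR].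
have -> : Phi (expR x) =
    mean (fun t => Phi (expR x) * (poisson z t * u t - x * poisson z t)).
  have puc : continuous (fun t => poisson z t * u t) by exact: continuousMR.
  have pxc : continuous (fun t => x * poisson z t) by exact: continuousZR.
  rewrite meanZ; last exact: continuousBR.
  rewrite meanB // meanZ // mean_poisson // -Re_herglotz /x.
  by ring.
rewrite Re_herglotz -meanZ; last exact: continuousMR.
apply: le_mean => [||t].
- by apply: continuousZR; apply: continuousBR; [exact: continuousMR|exact: continuousZR].
- by apply: continuousZR; exact: continuousMR.
have := ler_wpM2l (poisson_ge0 t z1) (AP x (u t)); lra.
Qed.

End GrowthFunctions.

(** * Luxemburg norms as circular means *)

Section HardyNorm.
Context {R : realType}.
Implicit Types (G : R[i] -> R[i]) (Phi : R -> R).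

Lemma integral_mean (f : R -> R) : continuous f ->
  (((2 * pi)^-1)%:E *
     \int[lebesgue_measure]_(t in `[0%R, (2 * pi)%R]) (f t)%:E = (mean f)%:E)%E.
Proof.
move=> fc; rewrite /mean EFinM; congr (_ * _)%E.
rewrite /Rint /Rintegral fineK //.
by apply: integrable_fin_num => //; apply: cont_on_integrable; exact: cont_onT.
Qed.

Lemma ccont_circle G (r : R) : holomorphic_on (unit_disk R) G -> 0 <= r < 1 ->
  ccont (fun t => G (r%:C * expi t)).
Proof.
move=> dG /andP[r0 r1]; apply: (@ccont_cdiff _ G) => [t|].
  apply: dG; change (normc (r%:C * expi t) < 1).
  by rewrite normcM normc_expi mulr1 normc_real ger0_norm.
by apply: ccontM; [exact: ccont_cst|exact: ccont_expi].
Qed.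

Definition modular Phi G (l r : R) : R :=
  mean (fun t => Phi (normc (G (r%:C * expi t)) / l)).

Lemma continuous_modular Phi G (l r : R) : lower_type_growth_function Phi ->
  holomorphic_on (unit_disk R) G -> 0 < l -> 0 <= r < 1 ->
  continuous (fun t => Phi (normc (G (r%:C * expi t)) / l)).
Proof.
move=> hPhi dG l0 r01; apply: continuous_ltgf => // [|t].
  apply: continuousMR; last exact: continuous_cstR.
  by apply: continuous_normc; exact: ccont_circle.
by rewrite divr_ge0 ?normc_ge0 // ltW.
Qed.

Lemma hardy_norm_le Phi G (N : R) : lower_type_growth_function Phi ->
  holomorphic_on (unit_disk R) G -> 0 < N ->
  (forall r, 0 <= r < 1 -> modular Phi G N r <= 1) ->
  (hardy_norm Phi G <= N%:E)%E.
Proof.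
move=> hPhi dG N0 GN; apply: ge_ereal_sup => _ [r /= rin <-].
have r01 : 0 <= r < 1 by move: rin; rewrite in_itv.
apply: ereal_inf_lbound; exists N => //; split => //.
rewrite integral_mean ?lee_fin; first exact: GN.
exact: (continuous_modular hPhi dG N0 r01).
Qed.

Lemma hardy_norm_lt Phi G (N : R) : lower_type_growth_function Phi ->
  holomorphic_on (unit_disk R) G -> (hardy_norm Phi G < N%:E)%E ->
  forall r, 0 <= r < 1 -> modular Phi G N r <= 1.
Proof.
move=> hPhi dG GN r r01.
have : (lux_norm Phi (dilate G r) < N%:E)%E.
  apply: le_lt_trans GN; apply: ereal_sup_ubound; exists r; last reflexivity.
  by rewrite -[_ r]/(is_true (r \in `[0, 1[)) in_itv.
move=> /ereal_inf_lt [_ [l [l0 lP] <-]]; rewrite lte_fin => lN.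
have N0 := lt_trans l0 lN.
move: lP; rewrite integral_mean; last exact: (continuous_modular hPhi dG l0 r01).
rewrite lee_fin; apply: le_trans; apply: le_mean => [||t].
- exact: (continuous_modular hPhi dG N0 r01).
- exact: (continuous_modular hPhi dG l0 r01).
apply: (ltgf_le hPhi); first by rewrite divr_ge0 ?normc_ge0 // ltW.
by rewrite ler_wpM2l ?normc_ge0 // lef_pV2 ?posrE // ltW.
Qed.

Lemma hardy_norm_ge0 Phi G : (0 <= hardy_norm Phi G)%E.
Proof.
apply: (@le_trans _ _ (lux_norm Phi (dilate G 0))).
  by apply: le_ereal_inf_tmp => _ [l [l0 _] <-]; rewrite lee_fin ltW.
apply: ereal_sup_ubound; exists 0; last reflexivity.
by rewrite -[_ 0]/(is_true (0 \in `[0, 1[)) in_itv /= lexx ltr01.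
Qed.

End HardyNorm.

(** * Products *)

Section Product.
Context {R : realType} (Phi1 Phi2 Phi3 : R -> R).
Hypotheses (hPhi1 : lower_type_growth_function Phi1)
           (hPhi2 : lower_type_growth_function Phi2)
           (hPhi3 : lower_type_growth_function Phi3).
Hypothesis hinv : growth_equiv (growth_inv Phi3)
  (fun t => growth_inv Phi1 t * growth_inv Phi2 t).

Lemma ltgf_eq0 (Phi : R -> R) (x : R) : lower_type_growth_function Phi ->
  0 <= x -> Phi x <= 0 -> x = 0.
Proof.
move=> hPhi x0 Px; apply/eqP; rewrite eq_le x0 andbT leNgt.
by apply: contraL Px => /(growth_gt0 (ltgf_growth hPhi)); rewrite ltNge.
Qed.

(** With [s] the larger of [Phi1 a] and [Phi2 b], the product [a * b] is at most
    the product of the inverse functions at [s], hence comparable with the inverse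
    of [Phi3] at [s]. *)
Lemma orlicz_young : exists2 c : R, 0 < c & forall a b : R, 0 <= a -> 0 <= b ->
  Phi3 (a * b / c) <= c * (Phi1 a + Phi2 b).
Proof.
have [c c0 cP] := hinv; exists c => // a b a0 b0.
have P1 := ltgf_ge0 hPhi1 a0; have P2 := ltgf_ge0 hPhi2 b0.
pose s := Num.max (Phi1 a) (Phi2 b).
have s1 : Phi1 a <= s by rewrite le_max lexx.
have s2 : Phi2 b <= s by rewrite le_max lexx orbT.
have [s0|s0] := leP s 0.
  rewrite (ltgf_eq0 hPhi1 a0 (le_trans s1 s0)) !mul0r.
  rewrite (growth_at0 (ltgf_growth hPhi3)) mulr_ge0 ?(ltW c0) // addr_ge0 //.
  by rewrite (growth_at0 (ltgf_growth hPhi1)).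
have cs : 0 <= c * s by rewrite mulr_ge0 // ltW.
have sS : s <= Phi1 a + Phi2 b by rewrite ge_max lerDl P2 lerDr P1.
apply: (@le_trans _ _ (c * s)); last by rewrite ler_wpM2l // ltW.
rewrite -[leRHS](growth_invK hPhi3) //.
apply: (ltgf_le hPhi3); first by rewrite divr_ge0 ?mulr_ge0 // ltW.
rewrite ler_pdivrMr // (mulrC _ c).
have [_] := cP s s0; apply: le_trans.
rewrite -(ltgfK hPhi1 a0) -(ltgfK hPhi2 b0).
by apply: ler_pM; rewrite ?growth_inv_ge0 // growth_inv_le.
Qed.

Lemma holomorphic_onM (D : set R[i]) (G1 G2 : R[i] -> R[i]) :
  holomorphic_on D G1 -> holomorphic_on D G2 ->
  holomorphic_on D (fun z => G1 z * G2 z).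
Proof. by move=> d1 d2 z Dz; apply: (cdiffM (d1 z Dz) (d2 z Dz)). Qed.

Lemma hardy_norm_product_lt : exists2 C : R, 0 < C &
  forall (G1 G2 : R[i] -> R[i]) (N1 N2 : R),
    holomorphic_on (unit_disk R) G1 -> holomorphic_on (unit_disk R) G2 ->
    0 < N1 -> 0 < N2 ->
    (hardy_norm Phi1 G1 < N1%:E)%E -> (hardy_norm Phi2 G2 < N2%:E)%E ->
    (hardy_norm Phi3 (fun z => G1 z * G2 z)%R <= (C * (N1 * N2))%R%:E)%E.
Proof.
have [c c0 cP] := orlicz_young.
have c2 : 0 < 2 * c by rewrite mulr_gt0.
have [lam lam1 lamP] := ltgf_scale hPhi3 (ltW c2).
have lam0 : 0 < lam by lra.
exists (c * lam); first exact: mulr_gt0.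
move=> G1 G2 N1 N2 d1 d2 N10 N20 G1N G2N.
have d12 := holomorphic_onM d1 d2.
have CN0 : 0 < c * lam * (N1 * N2) by rewrite !mulr_gt0.
apply: (hardy_norm_le hPhi3 d12 CN0) => r r01.
have m1 := hardy_norm_lt hPhi1 d1 G1N r01; have m2 := hardy_norm_lt hPhi2 d2 G2N r01.
rewrite -(ler_pM2l c2) mulr1 /modular.
have k1 := continuous_modular hPhi1 d1 N10 r01.
have k2 := continuous_modular hPhi2 d2 N20 r01.
have k3 : continuous (fun t => Phi3 (normc (G1 (r%:C * expi t) * G2 (r%:C * expi t)) /
    (c * lam * (N1 * N2)))).
  exact: (continuous_modular hPhi3 d12 CN0 r01).
rewrite -meanZ //.
apply: (@le_trans _ _ (c * (modular Phi1 G1 N1 r + modular Phi2 G2 N2 r))); last first.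
  by have := ler_wpM2l (ltW c0) m1; have := ler_wpM2l (ltW c0) m2; lra.
rewrite /modular -meanD // -meanZ; last exact: continuousDR.
apply: le_mean => [||t].
- exact: continuousZR.
- by apply: continuousZR; exact: continuousDR.
rewrite normcM; set g1 := normc _; set g2 := normc _.
have g10 : 0 <= g1 / N1 by rewrite divr_ge0 ?normc_ge0 // ltW.
have g20 : 0 <= g2 / N2 by rewrite divr_ge0 ?normc_ge0 // ltW.
apply: le_trans (cP _ _ g10 g20).
have -> : g1 * g2 / (c * lam * (N1 * N2)) = g1 / N1 * (g2 / N2) / c / lam.
  by field; rewrite !gt_eqF.
by apply: lamP; rewrite divr_ge0 ?(ltW c0) // mulr_ge0.
Qed.

Lemma hardy_norm_product : exists2 C : R, 0 < C &
  forall (G1 G2 : R[i] -> R[i]),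
    hardy_orlicz Phi1 G1 -> hardy_orlicz Phi2 G2 ->
    (hardy_norm Phi3 (fun z => G1 z * G2 z)%R <=
     C%:E * (hardy_norm Phi1 G1 * hardy_norm Phi2 G2))%E.
Proof.
have [C C0 CP] := hardy_norm_product_lt; exists C => // G1 G2 [d1 f1] [d2 f2].
have := hardy_norm_ge0 Phi1 G1; have := hardy_norm_ge0 Phi2 G2.
move: (CP G1 G2) f1 f2.
case: (hardy_norm Phi1 G1) => // n1; case: (hardy_norm Phi2 G2) => // n2.
move=> CG _ _; rewrite !lee_fin => n20 n10.
rewrite -!EFinM.
apply/lee_addgt0Pr => e e0.
pose K := C * (n1 + n2 + 1).
have K0 : 0 < K by rewrite mulr_gt0 //; lra.
pose d := Num.min 1 (e / K).
have d0 : 0 < d by rewrite lt_min ltr01 divr_gt0.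
have d1' : d <= 1 by rewrite ge_min lexx.
have dK : d * K <= e by rewrite -ler_pdivlMr // ge_min lexx orbT.
have n1d : (n1%:E < (n1 + d)%:E)%E by rewrite lte_fin ltrDl.
have n2d : (n2%:E < (n2 + d)%:E)%E by rewrite lte_fin ltrDl.
have n1d0 : 0 < n1 + d by lra.
have n2d0 : 0 < n2 + d by lra.
apply: le_trans (CG _ _ d1 d2 n1d0 n2d0 n1d n2d) _.
rewrite -EFinD lee_fin; apply: (@le_trans _ _ (C * (n1 * n2) + d * K)); last lra.
rewrite /K; have : C * (d * d) <= C * d by rewrite ler_wpM2l ?(ltW C0) // ler_piMr // ltW.
lra.
Qed.

End Product.

(** * Limits of Herglotz integrals along an ultrafilter *)

Section UltraLimit.
Context {R : realType} (U : set_system nat) {FU : UltraFilter U}.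
Implicit Types (x y : nat -> R[i]) (l m k : R[i]).

(** Convergence along an ultrafilter needs no extraction of subsequences: one
    ultrafilter serves for all points of the disk and all families at once. *)
Definition ulim x l : Prop := forall e : R, 0 < e -> U [set n | normc (x n - l) < e].

Lemma bounded_real_ulim (x : nat -> R) (M : R) : (forall n, `|x n| <= M) ->
  exists l : R, forall e : R, 0 < e -> U [set n | `|x n - l| < e].
Proof.
move=> xM; have FF := @ultra_proper _ _ FU.
have inM : (fmap x U) `[- M, M]%classic.
  apply: (@filterS _ U _ setT) => [n _|]; last exact: filterT.
  by rewrite /= in_itv /= -ler_norml; exact: xM.
have [l [_ lP]] := @segment_compact R (- M) M _ (fmap_proper_filter x FF) inM.
exists l => e e0.
have [//|UC] := in_ultra_setVsetC [set n | `|x n - l| < e] FU.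
have far : (fmap x U) (x @` [set n | ~ `|x n - l| < e]).
  by apply: (@filterS _ U _ _ _ _ UC) => n h; exists n.
have near : nbhs l [set y | `|y - l| < e].
  by apply/nbhs_normP; exists e => //= y; rewrite /ball_ /= distrC.
by have [y [[n /= ny yl]]] := lP _ _ far near; rewrite -yl.
Qed.

Lemma bounded_ulim x (M : R) : (forall n, normc (x n) <= M) -> exists l, ulim x l.
Proof.
move=> xM; have FF := @ultra_proper _ _ FU.
have [a aP] := bounded_real_ulim (fun n => le_trans (Re_le_normc _) (xM n)).
have [b bP] := bounded_real_ulim (fun n => le_trans (Im_le_normc _) (xM n)).
exists (a +i* b) => e e0; have e2 : 0 < e / 2 by rewrite divr_gt0.
apply: filterS (filterI (aP _ e2) (bP _ e2)) => n /= [h1 h2].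
apply: le_lt_trans (normc_le_ReIm _) _.
by case: (x n) h1 h2 => c d /=; lra.
Qed.

Lemma ulimB x y l m : ulim x l -> ulim y m -> ulim (fun n => x n - y n) (l - m).
Proof.
move=> xl ym e e0; have FF := @ultra_proper _ _ FU.
have e2 : 0 < e / 2 by rewrite divr_gt0.
apply: filterS (filterI (xl _ e2) (ym _ e2)) => n /= [h1 h2].
have -> : x n - y n - (l - m) = (x n - l) - (y n - m) by ring.
by apply: le_lt_trans (normcB _ _) _; lra.
Qed.

Lemma ulimZ k x l : ulim x l -> ulim (fun n => x n * k) (l * k).
Proof.
move=> xl e e0; have FF := @ultra_proper _ _ FU.
have k1 : 0 < normc k + 1 by rewrite ltr_wpDl ?normc_ge0.
apply: filterS (xl _ (divr_gt0 e0 k1)) => n /=; rewrite ltr_pdivlMr // => h.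
rewrite -mulrBl normcM; apply: le_lt_trans h.
by rewrite ler_wpM2l ?normc_ge0 // lerDl.
Qed.

Lemma ulim_normc_le x l (B : R) : ulim x l -> (forall n, normc (x n) <= B) ->
  normc l <= B.
Proof.
move=> xl xB; apply/ler_addgt0Pr => e e0; have FF := @ultra_proper _ _ FU.
have [n /= h] := @filter_ex _ _ FF _ (xl e e0).
have -> : l = x n - (x n - l) by ring.
by apply: le_trans (normcB _ _) _; have := xB n; lra.
Qed.

Lemma ulim_Re x l :
  ulim x l -> (fun n => Re (x n)) @ U --> Re l.
Proof.
move=> xl; have FF := @ultra_proper _ _ FU.
apply/cvgrPdist_lt => e e0; apply: filterS (xl e e0) => n /= h.
by rewrite distrC -raddfB; apply: le_lt_trans h; exact: Re_le_normc.
Qed.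

Lemma ultra_le (a b : nat -> R) (s t : R) :
  a @ U --> s -> b @ U --> t -> (forall n, a n <= b n) -> s <= t.
Proof.
move=> al bm ab; have FF := @ultra_proper _ _ FU.
apply: (@ler_cvg_to _ U FF R a b) => //.
exact: filterE.
Qed.

(** A compactness principle replacing normal families: the remainder estimate
    for Herglotz transforms is uniform on densities of bounded mass, so it
    survives a pointwise limit and makes the limit holomorphic. *)
Lemma herglotz_ulim (u : nat -> R -> R) (M : R) : (forall n, continuous (u n)) ->
  (forall n, mean (fun t => `|u n t|) <= M) ->
  exists2 H : R[i] -> R[i],
    forall z, normc z < 1 -> ulim (fun n => herglotz (u n) z) (H z) &
    forall z, normc z < 1 -> cdiff H z.
Proof.
move=> uc uM.
have /choice [H HP] : forall z : R[i], exists l, normc z < 1 ->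
    ulim (fun n => herglotz (u n) z) l.
  move=> z; have [z1|z1] := ltP (normc z) 1; last by exists 0.
  have [l lP] : exists l, ulim (fun n => herglotz (u n) z) l.
    apply: (@bounded_ulim _ (4 / (1 - normc z) * M)) => n.
    apply: le_trans (normc_herglotz (uc n) z1) _.
    by rewrite ler_wpM2l // divr_ge0 // subr_ge0 ltW.
  by exists l.
exists H => // z z1.
have [d dP] : exists d, ulim (fun n => herglotz_derive (u n) z) d.
  apply: (@bounded_ulim _ (4 / (1 - normc z) ^+ 2 * M)) => n.
  apply: le_trans (normc_herglotz_derive (uc n) z1) _.
  by rewrite ler_wpM2l // divr_ge0 // sqr_ge0.
pose rho := (1 + normc z) / 2.
have rho1 : rho < 1 by rewrite /rho; lra.
have zrho : normc z < rho by rewrite /rho; lra.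
apply: (@cdiff_of_remainder _ H d z rho (4 / (1 - rho) ^+ 3 * M)) => // w wrho.
have w1 := le_lt_trans wrho rho1.
apply: ulim_normc_le (ulimB (ulimB (HP w w1) (HP z z1)) (ulimZ (w - z) dP)) _ => n.
apply: le_trans (herglotz_remainder (uc n) rho1 (ltW zrho) wrho) _.
rewrite ler_wpM2r ?sqr_ge0 // ler_wpM2l // divr_ge0 // exprn_ge0 //.
by rewrite subr_ge0 ltW.
Qed.

End UltraLimit.

(** * Harmonic majorants *)

Section HarmonicMajorant.
Context {R : realType}.

(** A function dominated by the real part of a holomorphic [V] has all its
    circular means controlled by [V 0], by the mean value property. The bound [K]
    is then turned into 1 by [ltgf_scale]. *)
Lemma hardy_norm_le_majorant (Phi : R -> R) (K : R) :
  lower_type_growth_function Phi -> 0 <= K ->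
  exists2 L : R, 0 < L & forall (G V : R[i] -> R[i]) (l : R), 0 < l ->
    holomorphic_on (unit_disk R) G -> (forall z, normc z < 1 -> cdiff V z) ->
    (forall z, normc z < 1 -> Phi (normc (G z) / l) <= Re (V z)) ->
    Re (V 0) <= K -> (hardy_norm Phi G <= (l * L)%R%:E)%E.
Proof.
move=> hPhi K0; have K1 : 0 < K + 1 by lra.
have [L L1 LP] := ltgf_scale hPhi (ltW K1); have L0 : 0 < L by lra.
exists L => // G V l l0 dG dV GV VK.
have lL0 := mulr_gt0 l0 L0.
apply: (hardy_norm_le hPhi dG lL0) => r r01.
have [r0 r1] := andP r01.
have z1 (t : R) : normc (r%:C * expi t) < 1.
  by rewrite normcM normc_expi mulr1 normc_real ger0_norm.
have mV : mean (fun t => Re (V (0 + r%:C * expi t))) = Re (V 0).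
  by apply: mean_value => // z; rewrite subr0 => zr; apply: dV; exact: le_lt_trans r1.
have [Vc _] : ccont (fun t => V (0 + r%:C * expi t)).
  apply: (@ccont_cdiff _ V (fun t => 0 + r%:C * expi t)) => [t|].
    by rewrite add0r; exact: dV.
  apply: ccontD; first exact: ccont_cst.
  by apply: ccontM; [exact: ccont_cst|exact: ccont_expi].
rewrite -(ler_pM2l K1) mulr1; apply: (@le_trans _ _ (Re (V 0))); last lra.
have mc := continuous_modular hPhi dG lL0 r01.
rewrite -mV /modular -meanZ //; apply: le_mean => [||t] //; first exact: continuousZR.
rewrite add0r; apply: le_trans (GV _ (z1 t)).
have -> : normc (G (r%:C * expi t)) / (l * L) = normc (G (r%:C * expi t)) / l / L.
  by field; rewrite !gt_eqF.
by apply: LP; rewrite divr_ge0 ?normc_ge0 // ltW.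
Qed.

End HarmonicMajorant.

(** * The two factors on a closed disk *)

Section Factorization.
Context {R : realType} (Phi1 Phi2 Phi3 : R -> R).
Hypotheses (hPhi1 : lower_type_growth_function Phi1)
           (hPhi2 : lower_type_growth_function Phi2)
           (hPhi3 : lower_type_growth_function Phi3).

Lemma growth_equiv_le_prod :
  growth_equiv (growth_inv Phi3) (fun t => growth_inv Phi1 t * growth_inv Phi2 t) ->
  exists2 c : R, 0 < c & forall t, 0 < t ->
    growth_inv Phi3 t <= c * (growth_inv Phi1 (c * t) * growth_inv Phi2 (c * t)).
Proof.
move=> [c c0 cP]; exists c => // t t0.
have [+ _] := cP _ (mulr_gt0 c0 t0).
rewrite [c^-1 * (c * t)]mulrA mulVf ?gt_eqF // mul1r => h.
by rewrite mulrC -ler_pdivrMr // mulrC.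
Qed.

Variable c : R.
Hypothesis c0 : 0 < c.
Hypothesis cP : forall t, 0 < t ->
  growth_inv Phi3 t <= c * (growth_inv Phi1 (c * t) * growth_inv Phi2 (c * t)).

Section OneFunction.
Variables (F : R[i] -> R[i]) (kappa : R).
Hypotheses (kappa0 : 0 < kappa) (dF : forall z, normc z <= 1 -> cdiff F z).

(** Truncating from below at [kappa] keeps the logarithm finite and continuous at
    the zeros of [F]. *)
Definition boundary_max (t : R) : R := expR (log_max F kappa (expi t)).

Definition boundary_mass (t : R) : R := Phi3 (boundary_max t).

(** The logarithm of the modulus of the first factor on the circle. *)
Definition log_modulus (t : R) : R := ln (growth_inv Phi1 (c * boundary_mass t)).

Lemma boundary_maxE t : boundary_max t = Num.max (normc (F (expi t))) kappa.
Proof. by rewrite /boundary_max /log_max lnK // posrE log_max_pos. Qed.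

Lemma continuous_log_boundary : continuous (fun t => log_max F kappa (expi t)).
Proof.
apply: continuous_log_max => //; apply: ccont_cdiff (@ccont_expi R) => t.
by apply: dF; rewrite normc_expi.
Qed.

Lemma boundary_mass_gt0 t : 0 < boundary_mass t.
Proof. exact: (growth_gt0 (ltgf_growth hPhi3) (expR_gt0 _)). Qed.

Lemma continuous_boundary_mass : continuous boundary_mass.
Proof.
apply: continuous_ltgf => // [t|t]; last exact: expR_ge0.
by apply: continuous_comp; [exact: continuous_log_boundary|exact: continuous_expR].
Qed.

Lemma cmass_gt0 t : 0 < c * boundary_mass t.
Proof. by rewrite mulr_gt0 // boundary_mass_gt0. Qed.

Lemma expR_log_modulus t : expR (log_modulus t) = growth_inv Phi1 (c * boundary_mass t).
Proof. by rewrite lnK // posrE growth_inv_gt0 // cmass_gt0. Qed.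

Lemma continuous_log_modulus : continuous log_modulus.
Proof.
have h : continuous (fun t => growth_inv Phi1 (c * boundary_mass t)).
  apply: continuous_growth_inv => // [|t]; last exact: cmass_gt0.
  by apply: continuousZR; exact: continuous_boundary_mass.
move=> t; apply: (continuous_comp (h t)).
by apply: continuous_ln; rewrite growth_inv_gt0 // cmass_gt0.
Qed.

Lemma Phi1_log_modulus t : Phi1 (expR (log_modulus t)) = c * boundary_mass t.
Proof. by rewrite expR_log_modulus growth_invK // ltW // cmass_gt0. Qed.

(** The first factor is the outer function [expC (herglotz log_modulus z)], whose
    boundary modulus has [Phi1]-value exactly [c * boundary_mass]. *)
Lemma first_factor_bound (A : R) z :
  (forall (u : R -> R) z, continuous u -> normc z < 1 ->
    Phi1 (expR (Re (herglotz u z) - 1)) <=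
    A * Re (herglotz (fun t => Phi1 (expR (u t))) z)) ->
  normc z < 1 ->
  Phi1 (expR (Re (herglotz log_modulus z) - 1)) <= A * c * Re (herglotz boundary_mass z).
Proof.
move=> AP z1; have := AP _ _ continuous_log_modulus z1.
rewrite (_ : (fun t => Phi1 (expR (log_modulus t))) = fun t => c * boundary_mass t); last first.
  by apply/funext => t; exact: Phi1_log_modulus.
by rewrite Re_herglotzZ ?mulrA //; exact: continuous_boundary_mass.
Qed.

(** The second factor is [F] divided by the first. No zeros have to be removed:
    [log_poisson_majorant] bounds [F] by the outer function with modulus
    [boundary_max], and the quotient of the boundary moduli is at most [c] times
    the inverse of [Phi2] at [c * boundary_mass]. *)
Lemma second_factor_bound (A : R) z :
  0 < A ->
  (forall (u : R -> R) z, continuous u -> normc z < 1 ->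
    Phi2 (expR (Re (herglotz u z) - 1)) <=
    A * Re (herglotz (fun t => Phi2 (expR (u t))) z)) ->
  normc z < 1 ->
  Phi2 (normc (F z) / expR (Re (herglotz log_modulus z)) / (c * expR 1)) <=
  A * c * Re (herglotz boundary_mass z).
Proof.
move=> A0 AP z1.
(* Logarithm of the quotient of the boundary moduli, divided by [c]. *)
pose w t := log_max F kappa (expi t) - log_modulus t - ln c.
have lc := continuous_log_boundary; have mc := continuous_log_modulus.
have bc := continuous_boundary_mass; have pc := continuous_poisson z1.
have wc : continuous w.
  by apply: continuousBR; [exact: continuousBR|exact: continuous_cstR].
have wP t : Phi2 (expR (w t)) <= c * boundary_mass t.
  have m0 := cmass_gt0 t; have i0 := growth_inv_gt0 hPhi1 m0.
  rewrite -(growth_invK hPhi2 (ltW m0)); apply: (ltgf_le hPhi2 (expR_ge0 _)).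
  rewrite /w !expRB expR_log_modulus lnK ?posrE //.
  rewrite ler_pdivrMr // ler_pdivrMr //.
  have := cP (boundary_mass_gt0 t); rewrite {1}/boundary_mass ltgfK ?expR_ge0 //.
  by rewrite /boundary_max; lra.
have RewE : Re (herglotz w z) =
    Re (herglotz (fun t => log_max F kappa (expi t)) z) - Re (herglotz log_modulus z) - ln c.
  rewrite !Re_herglotz -[ln c]mulr1 -(mean_poisson z1) -meanZ // -!meanB //.
  - by apply: eq_mean => t; rewrite /w; ring.
  - by apply: continuousBR; exact: continuousMR.
  - exact: continuousZR.
  - exact: continuousMR.
  - exact: continuousMR.
apply: (@le_trans _ _ (Phi2 (expR (Re (herglotz w z) - 1)))).
  apply: (ltgf_le hPhi2).
    by rewrite !divr_ge0 ?normc_ge0 ?mulr_ge0 ?expR_ge0 // ltW.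
  rewrite RewE !expRB lnK ?posrE // invfM !mulrA.
  do 3![rewrite ler_wpM2r ?invr_ge0 ?expR_ge0 ?(ltW c0) //].
  exact: log_poisson_majorant.
apply: le_trans (AP _ _ wc z1) _; rewrite -mulrA ler_wpM2l ?(ltW A0) //.
rewrite -Re_herglotzZ // !Re_herglotz; apply: le_mean => [||t].
- apply: continuousMR => //; apply: continuous_ltgf => // t.
  by apply: continuous_comp; [exact: wc|exact: continuous_expR].
- by apply: continuousMR => //; exact: continuousZR.
by rewrite ler_wpM2l // poisson_ge0.
Qed.

End OneFunction.

End Factorization.

(** * Dilates and point evaluations *)

Section LimitFactorization.
Context {R : realType}.

Lemma cvg_ltgf (Phi : R -> R) (U : set_system nat) {FU : UltraFilter U}
    (a : nat -> R) (b : R) :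
  lower_type_growth_function Phi -> (forall n, 0 <= a n) -> 0 <= b ->
  a @ U --> b -> (fun n => Phi (a n)) @ U --> Phi b.
Proof.
move=> hPhi a0 b0 ab; have FF := @ultra_proper _ _ FU.
apply/cvgrPdist_lt => e e0; have [d d0 dP] := ltgf_continuous_at hPhi b0 e0.
move/cvgrPdist_lt : ab => /(_ _ d0); apply: filterS => n h.
by rewrite distrC; apply: dP => //; rewrite distrC.
Qed.

Definition normalized_dilate (G : R[i] -> R[i]) (lam r : R) (z : R[i]) : R[i] :=
  G (r%:C * z) / lam%:C.

Section NormalizedDilate.
Variables (Phi : R -> R) (G : R[i] -> R[i]) (lam r kappa : R).
Hypotheses (hPhi : lower_type_growth_function Phi) (lam0 : 0 < lam)
  (kappa0 : 0 < kappa) (r01 : 0 <= r < 1)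
  (dG : holomorphic_on (unit_disk R) G) (GM : modular Phi G lam r <= 1).

Let F := normalized_dilate G lam r.

Lemma normc_normalized_dilate z : normc (F z) = normc (G (r%:C * z)) / lam.
Proof. by rewrite /F /normalized_dilate normcM normcV normc_real gtr0_norm. Qed.

Lemma cdiff_normalized_dilate z : normc z <= 1 -> cdiff F z.
Proof.
move=> z1; apply: cdiffM; last exact: cdiff_cst.
have dm : cdiff (fun w : R[i] => r%:C * w) z.
  by apply: cdiffM; [exact: cdiff_cst|exact: cdiff_id].
apply: (cdiff_comp dm); apply: dG; change (normc (r%:C * z) < 1).
have [r0 r1] := andP r01.
rewrite normcM normc_real ger0_norm //; apply: le_lt_trans r1.
by rewrite ler_piMr.
Qed.

Lemma mean_boundary_mass :
  mean (fun t => `|boundary_mass Phi F kappa t|) <= 1 + Phi kappa.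
Proof.
have bc := continuous_boundary_mass hPhi kappa0 cdiff_normalized_dilate.
have mc := continuous_modular hPhi dG lam0 r01.
apply: (@le_trans _ _ (modular Phi G lam r + Phi kappa)); last by rewrite lerD2r.
rewrite /modular -[Phi kappa]mean_cst -meanD //; last exact: continuous_cstR.
apply: le_mean => [||t]; first exact: continuous_normR.
  by apply: continuousDR => //; exact: continuous_cstR.
rewrite ger0_norm; last exact/ltW/boundary_mass_gt0.
rewrite /boundary_mass boundary_maxE //.
rewrite normc_normalized_dilate.
have x0 : 0 <= normc (G (r%:C * expi t)) / lam by rewrite divr_ge0 ?normc_ge0 // ltW.
have := ltgf_ge0 hPhi x0; have := ltgf_ge0 hPhi (ltW kappa0).
by rewrite maxEle; case: ifP => _; lra.
Qed.

End NormalizedDilate.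

(** By [log_poisson_majorant] and [ltgf_jensen] a dilate of [G] is controlled by a
    Poisson integral of bounded mass. A function of zero norm satisfies the
    hypothesis for every [lam], hence vanishes on the disk. *)
Lemma evaluation_bound (Phi : R -> R) z : lower_type_growth_function Phi ->
  normc z < 1 -> exists B : R, forall G (lam : R), 0 < lam ->
    holomorphic_on (unit_disk R) G ->
    (forall r, 0 <= r < 1 -> modular Phi G lam r <= 1) ->
    normc (G z) <= B * lam.
Proof.
move=> hPhi z1; have [A A0 AP] := ltgf_jensen hPhi.
pose r := (1 + normc z) / 2; have n0 := normc_ge0 z.
have [r0 r1 zr] : [/\ 0 < r, r < 1 & normc z < r] by rewrite /r; split; lra.
have r01 : 0 <= r < 1 by rewrite (ltW r0).
have rN : r%:C != 0 :> R[i] by rewrite (fmorph_eq0 (@real_complex R)) gt_eqF.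
pose w := z / r%:C.
have w1 : normc w < 1.
  by rewrite normcM normcV normc_real gtr0_norm // ltr_pdivrMr // mul1r.
pose b := A * (4 / (1 - normc w) * (1 + Phi 1)).
have b0 : 0 <= b.
  rewrite mulr_ge0 ?(ltW A0) // mulr_ge0 ?divr_ge0 ?subr_ge0 ?(ltW w1) //.
  by rewrite addr_ge0 // (ltgf_ge0 hPhi).
exists (growth_inv Phi b * expR 1) => G lam lam0 dG GM.
pose F := normalized_dilate G lam r.
have dF x : normc x <= 1 -> cdiff F x by exact: cdiff_normalized_dilate.
have bc := continuous_boundary_mass hPhi ltr01 dF.
have lc := continuous_log_boundary ltr01 dF.
have Fw : normc (F w) = normc (G z) / lam.
  by rewrite normc_normalized_dilate // /w (mulrC r%:C) divfK.
rewrite -ler_pdivrMr // -Fw -ler_pdivrMr ?expR_gt0 // leNgt; apply/negP => h.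
have p0 : 0 <= normc (F w) / expR 1 by rewrite divr_ge0 ?normc_ge0 ?expR_ge0.
have := ltgf_increasing hPhi (growth_inv_ge0 hPhi b0) h.
rewrite growth_invK // ltNge => /negP; apply.
apply: (@le_trans _ _ (A * Re (herglotz (boundary_mass Phi F 1) w))).
  apply: le_trans (AP _ _ lc w1); apply: (ltgf_le hPhi p0).
  rewrite expRB ler_wpM2r ?invr_ge0 ?expR_ge0 //.
  exact: log_poisson_majorant.
rewrite ler_wpM2l ?(ltW A0) //.
apply: le_trans (ler_norm _) _; apply: le_trans (Re_le_normc _) _.
apply: le_trans (normc_herglotz bc w1) _.
rewrite ler_wpM2l ?divr_ge0 ?subr_ge0 ?(ltW w1) //.
by apply: mean_boundary_mass => //; exact: GM.
Qed.

End LimitFactorization.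

(** * Outer factorization *)

Section OuterFactorization.
Context {R : realType} (Phi1 Phi2 Phi3 : R -> R).
Hypotheses (hPhi1 : lower_type_growth_function Phi1)
           (hPhi2 : lower_type_growth_function Phi2)
           (hPhi3 : lower_type_growth_function Phi3).
Hypothesis hinv : growth_equiv (growth_inv Phi3)
  (fun t => growth_inv Phi1 t * growth_inv Phi2 t).

(** The choice of [kappa] makes the boundary modulus of the first factor at
    least 1, so its logarithm is nonnegative, and [ltgf_slope] at [x = 0] bounds it
    by a multiple of the boundary mass. *)
Lemma mean_log_modulus (c kappa : R) : 0 < c -> 0 < kappa ->
  c * Phi3 kappa = Phi1 1 ->
  exists M : R, forall F : R[i] -> R[i], (forall z, normc z <= 1 -> cdiff F z) ->
    mean (fun t => `|boundary_mass Phi3 F kappa t|) <= 1 + Phi3 kappa ->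
    mean (fun t => `|log_modulus Phi1 Phi3 c F kappa t|) <= M.
Proof.
move=> c0 k0 ck; have [A A0 AP] := ltgf_slope hPhi1.
have P10 : 0 < Phi1 1 by exact: (growth_gt0 (ltgf_growth hPhi1) ltr01).
exists (A * (c * (1 + Phi3 kappa)) / Phi1 1) => F dF mF.
have bc := continuous_boundary_mass hPhi3 k0 dF.
have uc := continuous_log_modulus hPhi1 hPhi3 c0 k0 dF.
have u0 t : 0 <= log_modulus Phi1 Phi3 c F kappa t.
  apply: ln_ge0; rewrite -(ltgfK hPhi1 ler01) -ck.
  apply: (growth_inv_le hPhi1); first by rewrite ck ltW.
  rewrite ler_wpM2l ?(ltW c0) //; apply: (ltgf_le hPhi3); first exact: ltW.
  by rewrite boundary_maxE // le_max lexx orbT.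
rewrite ler_pdivlMr // mulrC -meanZ; last exact: continuous_normR.
apply: le_trans (_ : mean (fun t => A * (c * `|boundary_mass Phi3 F kappa t|)) <= _); last first.
  rewrite !meanZ //; try exact: continuous_normR; last first.
    by apply: continuousZR; exact: continuous_normR.
  by rewrite !ler_wpM2l // ltW.
apply: le_mean => [||t].
- by apply: continuousZR; exact: continuous_normR.
- by do 2 apply: continuousZR; exact: continuous_normR.
rewrite ger0_norm // ger0_norm; last exact/ltW/boundary_mass_gt0.
rewrite -(Phi1_log_modulus hPhi1 hPhi3 c0).
by have := AP 0 (log_modulus Phi1 Phi3 c F kappa t); rewrite expR0 subr0.
Qed.

(** Factor the dilates of [G] of radius [r n] on the closed disk and pass to the
    limit along an ultrafilter, in the Herglotz integrals of the two densities
    [u n] (logarithm of the first factor) and [v n] (boundary mass). The real part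
    of the limit of the latter is a common harmonic majorant of both factors. *)
Lemma outer_factorization : exists L1 L2 : R, [/\ 0 < L1, 0 < L2 &
  forall (G : R[i] -> R[i]) (lam : R), 0 < lam -> holomorphic_on (unit_disk R) G ->
    (forall r, 0 <= r < 1 -> modular Phi3 G lam r <= 1) ->
    exists G1 G2 : R[i] -> R[i],
      [/\ holomorphic_on (unit_disk R) G1 /\ holomorphic_on (unit_disk R) G2,
          forall z, unit_disk R z -> G z = G1 z * G2 z,
          (hardy_norm Phi1 G1 <= L1%:E)%E &
          (hardy_norm Phi2 G2 <= (lam * L2)%R%:E)%E]].
Proof.
have [c c0 cP] := growth_equiv_le_prod hinv.
have [A1 A10 A1P] := ltgf_jensen hPhi1; have [A2 A20 A2P] := ltgf_jensen hPhi2.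
have P10 : 0 < Phi1 1 by exact: (growth_gt0 (ltgf_growth hPhi1) ltr01).
have P1c : 0 < Phi1 1 / c by rewrite divr_gt0.
pose kappa := growth_inv Phi3 (Phi1 1 / c).
have k0 : 0 < kappa by exact: growth_inv_gt0.
have ck : c * Phi3 kappa = Phi1 1.
  by rewrite growth_invK ?ltW // mulrC divfK // gt_eqF.
have [M MP] := mean_log_modulus c0 k0 ck.
pose B := 1 + Phi3 kappa.
have B0 : 0 <= B by rewrite addr_ge0 // ltgf_ge0 // ltW.
have K1 : 0 <= A1 * c * B by rewrite !mulr_ge0 // ltW.
have K2 : 0 <= A2 * c * B by rewrite !mulr_ge0 // ltW.
have [L1 L10 L1P] := hardy_norm_le_majorant hPhi1 K1.
have [L2 L20 L2P] := hardy_norm_le_majorant hPhi2 K2.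
exists (expR 1 * L1), (c * expR 1 * L2); split.
- by rewrite mulr_gt0 // expR_gt0.
- by rewrite !mulr_gt0 // expR_gt0.
move=> G lam lam0 dG GM.
pose r (n : nat) : R := 1 - n.+1%:R^-1.
have r01 n : 0 <= r n < 1.
  rewrite /r subr_ge0 invf_le1 ?ltr0n // ler1n /=.
  by rewrite ltrBlDr ltrDl invr_gt0 ltr0n.
pose F n := normalized_dilate G lam (r n).
have dF n z : normc z <= 1 -> cdiff (F n) z.
  by apply: cdiff_normalized_dilate => //; exact: r01.
pose v n := boundary_mass Phi3 (F n) kappa.
pose u n := log_modulus Phi1 Phi3 c (F n) kappa.
have vc n : continuous (v n) by exact: (continuous_boundary_mass hPhi3 k0 (dF n)).
have uc n : continuous (u n) by exact: (continuous_log_modulus hPhi1 hPhi3 c0 k0 (dF n)).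
have vB n : mean (fun t => `|v n t|) <= B.
  by apply: mean_boundary_mass => //; apply: GM; exact: r01.
have uM n : mean (fun t => `|u n t|) <= M by apply: MP (vB n); exact: dF.
have [U [FU sU]] := @ultraFilterLemma nat \oo _.
have FF := @ultra_proper _ _ FU.
have [V Vlim dV] := herglotz_ulim vc vB.
have [H Hlim dH] := herglotz_ulim uc uM.
pose O z := expC (H z).
have O0 z : O z != 0 by exact: expC_neq0.
have dO : holomorphic_on (unit_disk R) O.
  by move=> z z1; apply: (cdiff_comp (dH z z1)); exact: cdiff_expC.
have dK : holomorphic_on (unit_disk R) (fun z => G z / O z).
  by move=> z z1; apply: (cdiffM (dG z z1)); apply: (cdiffV (O0 z)); exact: dO.
have VB : Re (V 0) <= B.
  have z1 : normc (0 : R[i]) < 1 by rewrite normc0.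
  have Bc : (fun=> B) @ U --> B by exact: cvg_cst.
  apply: (ultra_le (ulim_Re (Vlim 0 z1)) Bc) => n; rewrite Re_herglotz0; apply: le_trans (vB n).
  apply: le_mean => //; [exact: continuous_normR|by move=> t; exact: ler_norm].
have dkV (k : R) z : normc z < 1 -> cdiff (fun w => k%:C * V w) z.
  by move=> z1; apply: cdiffM; [exact: cdiff_cst|exact: dV].
have RekV (k : R) z : Re (k%:C * V z) = k * Re (V z).
  by rewrite Re_mul /= mul0r subr0.
have ReHlim z (z1 : normc z < 1) := ulim_Re (Hlim z z1).
have ReVlim z (z1 : normc z < 1) := ulim_Re (Vlim z z1).
have ReVkc k z (z1 : normc z < 1) :
    (fun n => k * Re (herglotz (v n) z)) @ U --> k * Re (V z).
  by apply: cvgM; [exact: cvg_cst|exact: ReVlim].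
have Flim z : normc z < 1 -> (fun n => normc (F n z)) @ U --> normc (G z) / lam.
  move=> z1; have dz := dG z z1.
  apply/cvgrPdist_lt => e e0.
  have [d d0 dP] := cdiff_continuous dz (mulr_gt0 e0 lam0).
  have near0 : \forall n \near \oo, n.+1%:R^-1 < d := near_infty_natSinv_lt (PosNum d0).
  apply: filterS (sU _ near0) => n nd.
  rewrite normc_normalized_dilate // -mulrBl normrM (gtr0_norm (_ : 0 < lam^-1)) ?invr_gt0 //.
  rewrite ltr_pdivrMr // distrC; apply: le_lt_trans (normc_dist _ _) _; apply: dP.
  have -> : (r n)%:C * z - z = ((r n)%:C - 1) * z by rewrite mulrBl mul1r.
  rewrite normcM -(rmorphB (@real_complex R)) normc_real /r addrAC subrr add0r normrN.
  rewrite ger0_norm ?invr_ge0 //; apply: le_lt_trans nd.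
  by rewrite ler_piMr ?invr_ge0 // ltW.
have cvg1 z : normc z < 1 ->
    (fun n => Phi1 (expR (Re (herglotz (u n) z) - 1))) @ U --> Phi1 (expR (Re (H z) - 1)).
  move=> z1; apply: cvg_ltgf => //.
  apply: continuous_cvg; first exact: continuous_expR.
  by apply: cvgB; [exact: ReHlim|exact: cvg_cst].
have cvg2 z : normc z < 1 ->
    (fun n => Phi2 (normc (F n z) / expR (Re (herglotz (u n) z)) / (c * expR 1))) @ U -->
    Phi2 (normc (G z) / lam / expR (Re (H z)) / (c * expR 1)).
  move=> z1; have cP0 : 0 <= c * expR 1 by rewrite mulr_ge0 ?expR_ge0 // ltW.
  apply: cvg_ltgf => // [n||].
  - by rewrite !divr_ge0 ?normc_ge0 ?expR_ge0.
  - by rewrite !divr_ge0 ?normc_ge0 ?expR_ge0 // ltW.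
  apply: cvgMl; apply: cvgM; first exact: Flim.
  apply: cvgV; first by rewrite gt_eqF // expR_gt0.
  by apply: continuous_cvg; [exact: continuous_expR|exact: ReHlim].
have b1 z : normc z < 1 -> Phi1 (normc (O z) / expR 1) <= Re ((A1 * c)%:C * V z).
  move=> z1; rewrite normc_expC -expRB RekV.
  apply: (ultra_le (cvg1 z z1) (ReVkc (A1 * c) z z1)) => n.
  exact: (first_factor_bound hPhi1 hPhi3 c0 k0 (dF n) A1P z1).
have b2 z : normc z < 1 ->
    Phi2 (normc (G z / O z) / (lam * (c * expR 1))) <= Re ((A2 * c)%:C * V z).
  move=> z1; rewrite normcM normcV normc_expC RekV.
  have -> : normc (G z) / expR (Re (H z)) / (lam * (c * expR 1)) =
            normc (G z) / lam / expR (Re (H z)) / (c * expR 1).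
    by field; rewrite !gt_eqF ?expR_gt0.
  apply: (ultra_le (cvg2 z z1) (ReVkc (A2 * c) z z1)) => n.
  exact: (second_factor_bound hPhi1 hPhi2 hPhi3 c0 cP k0 (dF n) A20 A2P z1).
have V1 : Re ((A1 * c)%:C * V 0) <= A1 * c * B.
  by rewrite RekV ler_wpM2l // mulr_ge0 // ltW.
have V2 : Re ((A2 * c)%:C * V 0) <= A2 * c * B.
  by rewrite RekV ler_wpM2l // mulr_ge0 // ltW.
have lce : 0 < lam * (c * expR 1) by rewrite !mulr_gt0 // expR_gt0.
exists O, (fun z => G z / O z); split.
- by split.
- by move=> z _; rewrite mulrC divfK.
- exact: (L1P O _ _ (expR_gt0 1) dO (dkV (A1 * c)) b1 V1).
- rewrite (mulrA lam).
  exact: (L2P _ _ _ lce dK (dkV (A2 * c)) b2 V2).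
Qed.

End OuterFactorization.

(** * The theorem *)

Section NormComparison.
Context {R : realType}.

(** Values outside the disk do not enter the norm. *)
Lemma eq_hardy_norm (Phi : R -> R) (G G' : R[i] -> R[i]) :
  (forall z, unit_disk R z -> G z = G' z) -> hardy_norm Phi G = hardy_norm Phi G'.
Proof.
move=> GG'; congr ereal_sup; apply: eq_imagel => r /= rin.
have /andP[r0 r1] : 0 <= r < 1 by move: rin; rewrite in_itv.
congr ereal_inf; congr image; apply/funext => l /=.
congr (_ /\ is_true (_ * _ <= _)%E); apply: eq_integral => t _.
rewrite /dilate GG' //.
change (normc (r%:C * expi t) < 1).
by rewrite normcM normc_expi mulr1 normc_real ger0_norm.
Qed.

Lemma holomorphic_cst (D : set R[i]) (k : R[i]) : holomorphic_on D (fun=> k).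
Proof. by move=> z _; exact: cdiff_cst. Qed.

Lemma hardy_norm_zero (Phi : R -> R) : lower_type_growth_function Phi ->
  hardy_norm Phi (fun=> 0 : R[i]) = 0%E.
Proof.
move=> hPhi; apply/eqP; rewrite eq_le hardy_norm_ge0 andbT.
apply/lee_addgt0Pr => e e0; rewrite add0e.
have d0 : holomorphic_on (unit_disk R) (fun=> 0 : R[i]) by exact: holomorphic_cst.
apply: (hardy_norm_le hPhi d0 e0) => r _.
rewrite /modular (@eq_mean _ _ (fun=> 0)) ?mean_cst // => t.
by rewrite normc0 mul0r (growth_at0 (ltgf_growth hPhi)).
Qed.

Lemma hardy_norm_eq0 (Phi : R -> R) (G : R[i] -> R[i]) :
  lower_type_growth_function Phi -> holomorphic_on (unit_disk R) G ->
  hardy_norm Phi G = 0%E -> forall z, unit_disk R z -> G z = 0.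
Proof.
move=> hPhi dG G0 z z1; have [B BP] := evaluation_bound hPhi z1.
apply/eqP; rewrite -[_ == 0]negbK -normc_gt0 -leNgt.
have small lam : 0 < lam -> normc (G z) <= B * lam.
  move=> lam0; apply: BP => //; apply: hardy_norm_lt => //.
  by rewrite G0 lte_fin.
have B1 : 0 < `|B| + 1 by rewrite ltr_wpDl.
apply/ler_addgt0Pr => e e0; rewrite add0r.
apply: le_trans (small _ (divr_gt0 e0 B1)) _.
rewrite mulrCA ger_pMr // ler_pdivrMr // mul1r.
by have := ler_norm B; lra.
Qed.

End NormComparison.

Theorem theorem1p3 (R : realType) (Phi1 Phi2 Phi3 : R -> R)
    (hPhi1 : lower_type_growth_function Phi1)
    (hPhi2 : lower_type_growth_function Phi2)
    (hPhi3 : lower_type_growth_function Phi3)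
    (hinv : growth_equiv (growth_inv Phi3)
              (fun t => growth_inv Phi1 t * growth_inv Phi2 t)) :
  (forall G1 G2 : R[i] -> R[i],
     hardy_orlicz Phi1 G1 -> hardy_orlicz Phi2 G2 ->
     hardy_orlicz Phi3 (fun z => G1 z * G2 z)) /\
  (exists2 c : R, 0 < c &
     forall G : R[i] -> R[i], hardy_orlicz Phi3 G ->
     exists G1 G2 : R[i] -> R[i],
       [/\ hardy_orlicz Phi1 G1,
           hardy_orlicz Phi2 G2,
           (forall z, unit_disk R z -> G z = G1 z * G2 z) &
           approx_with c (hardy_norm Phi3 G)
             (hardy_norm Phi1 G1 * hardy_norm Phi2 G2)%E]).
Proof.
have [C C0 CP] := hardy_norm_product hPhi1 hPhi2 hPhi3 hinv.
have finite (Phi : R -> R) G : hardy_orlicz Phi G ->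
    exists2 n : R, 0 <= n & hardy_norm Phi G = n%:E.
  move=> [_]; have := hardy_norm_ge0 Phi G.
  case: (hardy_norm Phi G) => // n; rewrite lee_fin => n0 _; by exists n.
split=> [G1 G2 H1 H2|].
  split; first by apply: holomorphic_onM; [exact: (proj1 H1)|exact: (proj1 H2)].
  apply: le_lt_trans (CP _ _ H1 H2) _.
  have [n1 _ ->] := finite _ _ H1; have [n2 _ ->] := finite _ _ H2.
  by rewrite -!EFinM ltry.
have [L1 [L2 [L10 L20 LP]]] := outer_factorization hPhi1 hPhi2 hPhi3 hinv.
pose c := Num.max C (2 * L1 * L2).
have Cc : C <= c by rewrite le_max lexx.
have Lc : 2 * L1 * L2 <= c by rewrite le_max lexx orbT.
have c0 : 0 < c by exact: lt_le_trans Cc.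
exists c => // G HG; have [dG _] := HG; have [N N0 GN] := finite _ _ HG.
(* The construction needs a positive scale [lam > N]; for [N = 0] the function is
   zero on the disk. *)
have [N00|Npos] := eqVneq N 0.
  have G0 := hardy_norm_eq0 hPhi3 dG; rewrite GN N00 in G0.
  exists (fun=> 0), (fun=> 0); split.
  - by split; [exact: holomorphic_cst|rewrite hardy_norm_zero // ltry].
  - by split; [exact: holomorphic_cst|rewrite hardy_norm_zero // ltry].
  - by move=> z z1; rewrite mul0r; exact: G0.
  - by rewrite /approx_with GN N00 !hardy_norm_zero // !mule0.
have {}N0 : 0 < N by rewrite lt_neqAle eq_sym Npos.
have lam0 : 0 < 2 * N by rewrite mulr_gt0.
have GM r : 0 <= r < 1 -> modular Phi3 G (2 * N) r <= 1.
  by apply: hardy_norm_lt => //; rewrite GN lte_fin; lra.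
have [G1 [G2 [[d1 d2] GE n1L n2L]]] := LP G (2 * N) lam0 dG GM.
have H1 : hardy_orlicz Phi1 G1 by split => //; apply: le_lt_trans n1L (ltry _).
have H2 : hardy_orlicz Phi2 G2 by split => //; apply: le_lt_trans n2L (ltry _).
exists G1, G2; split => //.
have := CP _ _ H1 H2; rewrite -(eq_hardy_norm Phi3 GE) GN.
have [n1 n10 E1] := finite _ _ H1; have [n2 n20 E2] := finite _ _ H2.
move: n1L n2L; rewrite E1 E2 -!EFinM /approx_with -!EFinM !lee_fin => n1L n2L NC.
split.
  rewrite mulrC ler_pdivrMr //.
  apply: (@le_trans _ _ (L1 * (2 * N * L2))); first exact: ler_pM.
  by have := ler_wpM2l (ltW N0) Lc; lra.
by apply: le_trans NC _; rewrite ler_wpM2r // mulr_ge0.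
Qed.
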